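(* Let $m\neq\pm1$ be a square-free integer, $p$ a prime with $p\nmid m$, and $k$ a positive integer. Let $f(X)=X^{p^k}-m$, $\alpha$ a root of $f$, and $s:=v_p(m^p-m)-1$. (i) If $s\leq k$, then $\operatorname{ind}_p(\alpha)=\dfrac{p^k-p^{k-s}}{p-1}$. (ii) If $k<s$, then $\operatorname{ind}_p(\alpha)=\dfrac{p^k-1}{p-1}$.
   Context: For an algebraic integer $\alpha$ generating a number field $K=\mathbb{Q}(\alpha)$ with ring of integers $\mathcal{O}_K$, the index is $\operatorname{ind}(\alpha)=(\mathcal{O}_K^+:\mathbb{Z}[\alpha]^+)$ (index of additive groups), and the $p$-index is $\operatorname{ind}_p(\alpha)=v_p(\operatorname{ind}(\alpha))$, where $v_p$ is the $p$-adic valuation. *)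

(* Defs.v *)
From HB Require Import structures.
From mathcomp Require Import all_boot all_order all_algebra all_field.
Set Implicit Arguments. Unset Strict Implicit. Unset Printing Implicit Defensive.
Import Order.TTheory GRing.Theory Num.Theory.
Local Open Scope ring_scope.

Definition inQa (a x : algC) : Prop :=
  exists q : {poly algC}, q \is a polyOver Crat /\ x = q.[a].

Definition inZa (a x : algC) : Prop :=
  exists q : {poly algC}, q \is a polyOver Num.int /\ x = q.[a].

Definition inOK (a x : algC) : Prop := inQa a x /\ x \in Aint.

(* is_index a n : the additive index (O_K^+ : Z[a]^+) is finite and equals n,
   i.e. the quotient group O_K / Z[a] has exactly n elements: there are n
   elements of O_K, pairwise incongruent mod Z[a], representing every class. *)
Definition is_index (a : algC) (n : nat) : Prop :=
  exists s : seq algC,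
    [/\ size s = n,
        (forall i, (i < n)%N -> inOK a s`_i),
        (forall i j, (i < n)%N -> (j < n)%N -> i <> j -> ~ inZa a (s`_i - s`_j)) &
        (forall x, inOK a x -> exists2 i, (i < n)%N & inZa a (x - s`_i))].

Definition squarefree_int (m : int) : Prop :=
  forall q : nat, prime q -> ~~ (q ^ 2 %| `|m|)%N.

(* Main.v *)
Require Import Defs.
From HB Require Import structures.
From mathcomp Require Import all_boot all_order all_algebra all_field.
From mathcomp Require Import boolp classical_sets.
From mathcomp Require Import ring lra zify.
Set Implicit Arguments. Unset Strict Implicit. Unset Printing Implicit Defensive.
Import Order.TTheory GRing.Theory Num.Theory.
Local Open Scope ring_scope.

(* Write N = p^k.  Extend the p-adic valuation to a valuation v of the algebraic
   numbers.  The conjugates x of alpha differ by p-power roots of unity u, and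
   v(1 - u) is known; taking for x the conjugate closest to m, the factorization
   of x^(p^b) - m^(p^b) into conjugates of x - m together with
   v(m - m^N) = s + 1 determines all the slopes of the Newton polygon of
   (T + m)^N - m.  The elements
     theta_b (alpha - m)^e,
     theta_b = (alpha^N - m^N) / (alpha^(p^b) - m^(p^b)) / p^(k-b),
   where max(0, k - s) <= b <= k, are integral, and one of them has each degree
   below N.  At a conjugate belonging to the side b of the polygon the
   valuations of the theta_b (x - m)^e are distinct fractions in [0, 1) and are
   dominated by those of the other sides, so that they form a basis of O_K
   locally at p.  The p-index is the sum of the exponents k - b of their leading
   denominators. *)

(** * Valuations of the algebraic numbers above a prime *)

(** A valuation on all algebraic numbers stands in for the primes of [O_K] above [p], which are
    never determined: they are seen by evaluating one polynomial at several conjugates of [alpha]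
    under a fixed [v], and roots of unity are at hand without extending any field. The price is that
    [v] has to be constructed, and that integrality has to be tested on every such [v]. The centre
    [m] is natural because X^N - m is (X - m)^N modulo [p]; and [s] can be read off m^p - m,
    whatever [k] is, because v(m^(p^j) - m) is the same for all j > 0. The power of [p] in each
    leading denominator is squeezed: integrality of the displayed elements bounds it from below,
    local independence from above. For the latter, rational coefficients have integral valuations,
    so the fractional parts separate the terms of one side; ties between sides are broken at the
    conjugate of the largest side index. The obstacle is [p = 2], where two sides may share a slope
    and two terms may tie; then their residues decide. *)

Definition padic_valuation (p : nat) (v : algC -> rat) : Prop :=
  [/\ forall x y, x != 0 -> y != 0 -> v (x * y) = v x + v y,
      forall x y, x != 0 -> y != 0 -> x + y != 0 -> Num.min (v x) (v y) <= v (x + y),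
      v p%:R = 1 & forall x, x \in Aint -> x != 0 -> 0 <= v x].

Lemma int_eigen_Aint n (x : algC) (v : 'rV[algC]_n) (A : 'M[int]_n) :
  v != 0 -> x *: v = v *m map_mx intr A -> x \in Aint.
Proof.
move=> nz_v Dv; apply: (@root_monic_Aint (char_poly (map_mx intr A))).
- by rewrite -eigenvalue_root_char; apply/eigenvalueP; exists v.
- exact: char_poly_monic.
rewrite -map_char_poly; apply/polyOverP=> i; rewrite coef_map /=.
by rewrite rpred_int.
Qed.

(* Multiplication by this number maps the lattice spanned by the powers
   [x ^+ i], [i < (size C).-1], to itself. *)
Lemma Aint_horner_drop_poly (C : {poly int}) (x : algC) m :
  C != 0 -> root (map_poly intr C) x ->
  (map_poly intr (drop_poly m C)).[x] \in Aint.
Proof.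
move=> nzC Cx0; have [leCm | ltmC] := leqP (size C) m.
  by rewrite drop_poly_eq0 // rmorph0 horner0 Aint0.
have injZ : injective (intr : int -> algC) by exact: intr_inj.
have gt1C : (1 < size C)%N.
  rewrite -(size_map_inj_poly injZ) //; apply: root_size_gt1 Cx0.
  by rewrite -size_poly_eq0 size_map_inj_poly // size_poly_eq0.
pose n := (size C).-2.+1.
have sC : size C = n.+1 by rewrite /n; case: (size C) gt1C => [|[]].
have lemn : (m <= n)%N by rewrite -ltnS -sC.
(* Below [m] the product has small enough degree as it stands; from [m] on, the equation of [x]
   trades [t * x ^+ m] for minus the value of the low part of [C]. *)
pose T i := if (i < m)%N then drop_poly m C * 'X^i
            else - (take_poly m C * 'X^(i - m)).
have sT i : (i < n)%N -> (size (T i) <= n)%N.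
  move=> ltin; rewrite /T; case: ltnP => im.
    apply: leq_trans (size_polyMleq _ _) _.
    rewrite size_polyXn size_drop_poly sC; lia.
  rewrite size_polyN; apply: leq_trans (size_polyMleq _ _) _.
  rewrite size_polyXn addnS /=; apply: leq_trans (leq_add (size_take_poly m C) (leqnn _)) _.
  by rewrite subnKC // ltnW.
set t := _.[x].
have Dt i : t * x ^+ i = (map_poly intr (T i)).[x].
  rewrite /T; case: ltnP => im.
    by rewrite rmorphM /= map_polyXn hornerM hornerXn.
  have: (map_poly intr (take_poly m C + drop_poly m C * 'X^m)).[x] = 0.
    by rewrite poly_take_drop; apply/rootP.
  rewrite rmorphD rmorphM /= map_polyXn hornerD hornerM hornerXn -/t.
  move/eqP; rewrite addrC addr_eq0 => /eqP Dtm.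
  rewrite -{1}(subnKC im) exprD mulrA Dtm rmorphN rmorphM /= map_polyXn.
  by rewrite hornerN hornerM hornerXn mulNr.
pose v := \row_(i < n) x ^+ i.
apply: (@int_eigen_Aint n t v (\matrix_(l < n, i < n) (T i)`_l)).
  apply/eqP=> /rowP/(_ ord0); rewrite !mxE expr0 => /eqP.
  by rewrite oner_eq0.
apply/rowP=> i; rewrite !mxE Dt (@horner_coef_wide _ n); last first.
  by rewrite size_map_inj_poly // sT.
by apply: eq_bigr => l _; rewrite !mxE coef_map mulrC.
Qed.

Definition proper_ideal (I : algC -> Prop) : Prop :=
  [/\ forall x, I x -> x \in Aint, I 0,
      forall x y, I x -> I y -> I (x + y),
      forall a x, a \in Aint -> I x -> I (a * x) & ~ I 1].

(** Zorn's lemma; maximality is phrased as invertibility modulo [M], the form used later: without an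
    inverse of [x], the ideal generated by [M] and [x] would be proper and larger. *)
Lemma maximal_ideal_exists (I : algC -> Prop) : proper_ideal I ->
  exists M, [/\ proper_ideal M, forall x, I x -> M x &
    forall x, x \in Aint -> ~ M x -> exists2 a, a \in Aint & M (1 - a * x)].
Proof.
move=> propI.
pose P (X : set algC) := X = set0 \/ proper_ideal X /\ (forall x, I x -> X x).
have [F FP totF | M [PM maxM]] := @Zorn_bigcup _ P.
  have [allF0 | ] := pselect (forall X, F X -> X = set0).
    by left; rewrite -subset0 => x [X /allF0-> //].
  move=> /existsNP[X0 /not_implyP[FX0 nzX0]]; right.
  have mono X x : F X -> X x ->
      exists2 Y, F Y & proper_ideal Y /\ (forall y, I y -> Y y) /\ Y x.
    move=> FX Xx; exists X => //; have [X_0|[? ?]] := FP X FX => //.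
    by rewrite X_0 in Xx.
  have [X_0|[propX0 IX0]] := FP X0 FX0 => //.
  split; last by move=> x Ix; exists X0 => //; apply: IX0.
  split.
  - by move=> x [X FX Xx]; have [Y _ [[AY _ _ _ _] [_ Yx]]] := mono X x FX Xx; apply: AY.
  - by exists X0 => //; case: propX0.
  - move=> x y [X FX Xx] [Y FY Yy].
    have [ZX FZX [[_ _ ZXD _ _] [_ ZXx]]] := mono X x FX Xx.
    have [ZY FZY [[_ _ ZYD _ _] [_ ZYy]]] := mono Y y FY Yy.
    have [sZ | sZ] := totF _ _ FZX FZY; first by exists ZY => //; apply: ZYD => //; apply: sZ.
    by exists ZX => //; apply: ZXD => //; apply: sZ.
  - move=> a x Aa [X FX Xx]; have [Y FY [[_ _ _ YM _] [_ Yx]]] := mono X x FX Xx.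
    by exists Y => //; apply: YM.
  - by move=> [X FX X1]; have [Y _ [[_ _ _ _ n1] [_ Y1]]] := mono X 1 FX X1.
have [I_A I_0 _ _ _] := propI.
have {PM} [M0|[propM IM]] := PM.
  case: (maxM I); last by right.
  by split; [rewrite M0; apply: sub0set | rewrite M0 => /(_ 0 I_0)].
exists M; split=> // x Ax nMx.
have [M_A M_0 M_D M_M M_1] := propM.
pose N y := exists2 a, a \in Aint & exists2 z, M z & y = z + a * x.
apply: contrapT => no_inv; case: (maxM N).
  split=> [y My | sNM]; first by exists 0 => //; exists y; rewrite ?mul0r ?addr0.
  by apply/nMx/sNM; exists 1; rewrite ?Aint1 //; exists 0; rewrite ?mul1r ?add0r.
right; split; last by move=> y Iy; exists 0 => //; exists y; [apply: IM | rewrite mul0r addr0].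
split.
- by move=> _ [a Aa [z /M_A Az ->]]; rewrite rpredD ?rpredM.
- by exists 0 => //; exists 0; rewrite ?mul0r ?addr0.
- move=> _ _ [a Aa [z Mz ->]] [b Ab [t Mt ->]].
  by exists (a + b); [rewrite rpredD | exists (z + t); [apply: M_D | ring]].
- move=> c _ Ac [a Aa [z Mz ->]].
  by exists (c * a); [rewrite rpredM | exists (c * z); [apply: M_M | ring]].
move=> [a Aa [z Mz D1]]; apply: no_inv; exists a => //.
by rewrite D1 addrK.
Qed.

Lemma map_poly_ratr_intr (C : {poly int}) :
  map_poly ratr (map_poly intr C : {poly rat}) = map_poly intr C :> {poly algC}.
Proof. by apply/polyP=> i; rewrite !coef_map /= ratr_int. Qed.

(** Content 1 is the point: no prime divides all the coefficients. *)
Lemma primitive_int_root (x : algC) :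
  exists C : {poly int}, [/\ C != 0, zcontents C = 1 & root (map_poly intr C) x].
Proof.
have [q [Dq mon_q] q_dv] := minCpolyP x.
have [C0 [a nza DC0]] := rat_poly_scale q.
have nzq := monic_neq0 mon_q.
have nzC0 : C0 != 0 by apply: contraNneq nzq => C0_0; rewrite DC0 C0_0 map_poly0 scaler0.
exists (zprimitive C0); rewrite zprimitive_eq0 zcontents_primitive nzC0; split=> //.
rewrite -map_poly_ratr_intr q_dv DC0 [in map_poly _ C0](zpolyEprim C0) map_polyZ scalerA.
by rewrite dvdpZl ?dvdpp // mulf_neq0 ?invr_eq0 ?intr_eq0 ?zcontents_eq0.
Qed.

(** * The local ring at a maximal ideal above p, and its valuation *)

Section LocalRing.

Variables (p : nat) (M : algC -> Prop).
Hypotheses (p_pr : prime p) (M_proper : proper_ideal M) (Mp : M p%:R).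
Hypothesis M_max : forall x, x \in Aint -> ~ M x -> exists2 a, a \in Aint & M (1 - a * x).

Lemma maximal_ideal_prime x y : x \in Aint -> y \in Aint -> ~ M x -> ~ M y -> ~ M (x * y).
Proof.
have [M_A M_0 M_D M_M M_1] := M_proper.
move=> Ax Ay nMx nMy Mxy.
have [a Aa Ma] := M_max Ax nMx; have [b Ab Mb] := M_max Ay nMy.
apply: M_1; have -> : 1 = (1 - a * x) + a * x * (1 - b * y) + a * b * (x * y) by ring.
by apply: (M_D); [apply: (M_D) => //; apply: (M_M) => //; rewrite rpredM | apply: (M_M) => //;
  rewrite rpredM].
Qed.

(** The localization at [M], described by denominators so that no new ring has to be built;
    [in_local_ideal] is its maximal ideal. *)
Definition in_local (x : algC) : Prop :=
  exists b, [/\ b \in Aint, ~ M b & b * x \in Aint].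

Definition in_local_ideal (x : algC) : Prop :=
  exists b, [/\ b \in Aint, ~ M b & M (b * x)].

Definition local_unit (x : algC) : Prop :=
  [/\ x != 0, in_local x & in_local x^-1].

Lemma in_local_Aint x : x \in Aint -> in_local x.
Proof.
have [_ _ _ _ M_1] := M_proper.
by move=> Ax; exists 1; rewrite mul1r Aint1.
Qed.

Lemma in_localM x y : in_local x -> in_local y -> in_local (x * y).
Proof.
move=> [b [Ab Mb Abx]] [c [Ac Mc Acy]]; exists (b * c).
by split; [apply: rpredM | apply: maximal_ideal_prime | rewrite mulrACA; apply: rpredM].
Qed.

Lemma in_localD x y : in_local x -> in_local y -> in_local (x + y).
Proof.
move=> [b [Ab Mb Abx]] [c [Ac Mc Acy]]; exists (b * c); split.
- by rewrite rpredM.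
- exact: maximal_ideal_prime.
have -> : b * c * (x + y) = c * (b * x) + b * (c * y) by ring.
by apply: rpredD; apply: rpredM.
Qed.

Lemma in_localX x n : in_local x -> in_local (x ^+ n).
Proof.
move=> Vx; elim: n => [|n IHn]; first by rewrite expr0; apply: in_local_Aint; rewrite Aint1.
by rewrite exprS; apply: in_localM.
Qed.

Lemma in_local_idealD x y : in_local_ideal x -> in_local_ideal y -> in_local_ideal (x + y).
Proof.
have [M_A _ M_D M_M _] := M_proper.
move=> [b [Ab Mb Mbx]] [c [Ac Mc Mcy]]; exists (b * c); split.
- by rewrite rpredM.
- exact: maximal_ideal_prime.
have -> : b * c * (x + y) = c * (b * x) + b * (c * y) by ring.
by apply: (M_D); apply: (M_M).
Qed.

Lemma in_local_ideal_nonunit x : x != 0 -> in_local x -> ~ in_local x^-1 -> in_local_ideal x.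
Proof.
move=> nzx [b [Ab Mb Abx]] nVx; exists b; split=> //.
apply: contrapT => nMbx; apply: nVx; exists (b * x); split=> //.
by rewrite mulfK.
Qed.

Lemma int_maximal_idealP (c : int) : M c%:~R -> (p%:Z %| c)%Z.
Proof.
have [M_A M_0 M_D M_M M_1] := M_proper.
move=> Mc; apply: contraT => ndvd.
have cop : coprimez c p%:Z by rewrite coprimezE coprime_sym prime_coprime.
have [[u w] /= Duw] := coprimezP _ _ cop.
case: M_1; have -> : 1 = u%:~R * c%:~R + w%:~R * p%:R :> algC.
  by rewrite -(intrM _ u) -[p%:R]/(p%:Z%:~R) -intrM -intrD Duw.
by apply: (M_D); apply: (M_M); rewrite ?Aint_int.
Qed.

(* If both the tails [t_j] of a primitive integer polynomial evaluated at one
   of its roots [x] and the products [x * t_j] were all in [M], so would be all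
   coefficients, which are coprime. *)
Lemma in_local_total x : x != 0 -> in_local x \/ in_local x^-1.
Proof.
have [M_A M_0 M_D M_M M_1] := M_proper.
move=> nzx; have [C [nzC C1 Cx0]] := primitive_int_root x.
have Cx : (map_poly intr C).[x] = 0 by apply/rootP.
pose t j := (map_poly intr (drop_poly j C)).[x] : algC.
have At j : t j \in Aint by apply: Aint_horner_drop_poly.
have Dt j : t j = (C`_j)%:~R + x * t j.+1.
  rewrite /t -{1}(poly_take_drop 1 (drop_poly j C)) rmorphD rmorphM /= map_polyXn.
  have -> : take_poly 1 (drop_poly j C) = (C`_j)%:P.
    by apply/polyP=> i; rewrite coef_take_poly coef_drop_poly coefC; case: i.
  have -> : drop_poly 1 (drop_poly j C) = drop_poly j.+1 C.
    by apply/polyP=> i; rewrite !coef_drop_poly; congr (_`_ _); lia.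
  by rewrite map_polyC hornerD hornerC hornerM hornerXn mulrC.
have Axt j : x * t j.+1 \in Aint.
  by have -> : x * t j.+1 = t j - (C`_j)%:~R; [rewrite (Dt j); ring | rewrite rpredB ?Aint_int].
have [allM | ] := pselect (forall j, M (t j) /\ M (x * t j.+1)); last first.
  (* A tail outside [M] is a denominator of [x], a product outside [M] one of the inverse of [x].
     Index 0 cannot occur, as [t 0] vanishes. *)
  move=> /existsNP[j /not_andP[nM | nM]].
    case: j nM => [|j] nM; first by case: nM; rewrite /t drop_poly0l Cx.
    by left; exists (t j.+1); split=> //; rewrite mulrC.
  by right; exists (x * t j.+1); split=> //; rewrite mulrAC divff ?mul1r.
suff: (p%:Z %| zcontents C)%Z by rewrite C1 dvdz1 absz_nat => /eqP p1; move: (p_pr); rewrite p1.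
rewrite dvdz_contents; apply/polyOverP=> j.
suff MC : M (C`_j)%:~R by apply: int_maximal_idealP.
have [Mt Mxt] := allM j.
have -> : (C`_j)%:~R = t j + (-1) * (x * t j.+1) by rewrite (Dt j); ring.
by apply: (M_D) => //; apply: (M_M); rewrite ?rpredN ?Aint1.
Qed.

Let p_neq0 : p%:R != 0 :> algC.
Proof. by rewrite pnatr_eq0 -lt0n prime_gt0. Qed.

Lemma local_unitM x y : local_unit x -> local_unit y -> local_unit (x * y).
Proof.
move=> [nzx Vx Vx'] [nzy Vy Vy']; split; rewrite ?mulf_neq0 ?invfM //; exact: in_localM.
Qed.

Lemma local_unitV x : local_unit x -> local_unit x^-1.
Proof. by move=> [nzx Vx Vx']; split; rewrite ?invr_eq0 ?invrK. Qed.

Lemma local_unit1 : local_unit 1.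
Proof. by split; rewrite ?oner_eq0 ?invr1 //; apply: in_local_Aint; rewrite Aint1. Qed.

Lemma local_unitX x n : local_unit x -> local_unit (x ^+ n).
Proof.
move=> Ux; elim: n => [|n IHn]; first exact: local_unit1.
by rewrite exprS; apply: local_unitM.
Qed.

Lemma not_in_local_invp : ~ in_local p%:R^-1.
Proof.
have [_ _ _ M_M _] := M_proper.
move=> [b [Ab Mb Abp]]; apply: Mb.
by rewrite -(divfK p_neq0 b); apply: M_M.
Qed.

Lemma in_local_pXz (z : int) : in_local (p%:R ^ z) -> 0 <= z.
Proof.
case: z => [//|n] Vn; case: not_in_local_invp.
have -> : p%:R^-1 = p%:R ^+ n * (p%:R ^+ n.+1)^-1 :> algC.
  by rewrite exprS invfM mulrC divfK // expf_neq0.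
by apply: in_localM => //; apply/in_localX/in_local_Aint/(Aint_int p).
Qed.

Lemma local_unit_pXz (z : int) : local_unit (p%:R ^ z) -> z = 0.
Proof.
case=> _ /in_local_pXz z_ge0; rewrite invr_expz => /in_local_pXz; lia.
Qed.

Lemma int_local_unit (c : int) : c != 0 ->
  exists e : nat, local_unit (c%:~R / p%:R ^+ e).
Proof.
move=> nzc; have cgt0 : (0 < `|c|)%N by rewrite absz_gt0.
have [m cop_pm Dc] := pfactor_coprime p_pr cgt0.
exists (logn p `|c|).
set e := logn p _ in Dc *; pose d : int := (-1) ^+ (c < 0)%R * m%:Z.
have Dd : c%:~R = d%:~R * p%:R ^+ e :> algC.
  by rewrite [c in LHS]intEsign Dc /d 2!intrM -[(Posz m)%:~R]/(m%:R) -mulrA -natrX -natrM.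
have pe : p%:R ^+ e != 0 :> algC by rewrite expf_neq0.
have nzd : d%:~R != 0 :> algC.
  by apply: contraNneq nzc => d0; rewrite -(intr_eq0 algC) Dd d0 mul0r.
rewrite Dd mulfK //; split=> //; first by apply: in_local_Aint; rewrite Aint_int.
exists d%:~R; rewrite divff // Aint_int Aint1; split=> //.
move/int_maximal_idealP; rewrite dvdzE abszMsign /=; apply/negP.
by rewrite -prime_coprime.
Qed.

Lemma local_least_divisor (T : eqType) (t : T -> algC) (i : T) (s : seq T) :
  (forall j, j \in i :: s -> t j != 0) ->
  exists2 l, l \in i :: s & forall j, j \in i :: s -> in_local (t j / t l).
Proof.
elim: s i => [|i' s IHs] i nzt.
  exists i; rewrite ?inE // => j; rewrite inE => /eqP->.
  by rewrite divff ?nzt ?inE //; apply: in_local_Aint; rewrite Aint1.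
have [|l sl lmin] := IHs i'; first by move=> j sj; rewrite nzt // inE sj orbT.
have nztl : t l != 0 by rewrite nzt // inE sl orbT.
have nzti : t i != 0 by rewrite nzt // inE eqxx.
have [Vil | Vli] := in_local_total (mulf_neq0 nzti (invr_neq0 nztl)).
  exists l; first by rewrite inE sl orbT.
  by move=> j; rewrite inE => /predU1P[-> | /lmin].
exists i; first by rewrite inE eqxx.
move=> j; rewrite inE => /predU1P[-> | /lmin Vjl].
  by rewrite divff //; apply: in_local_Aint; rewrite Aint1.
have -> : t j / t i = t j / t l * (t i / t l)^-1 by field; rewrite nztl nzti.
exact: in_localM.
Qed.

(* In the equation of [x] over the integers, two terms have to be associated
   in the local ring. *)
Lemma local_exponent x : x != 0 ->
  exists n (a : int), (0 < n)%N /\ local_unit (x ^+ n * p%:R ^ (- a)).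
Proof.
move=> nzx; have [C [nzC _ /rootP Cx]] := primitive_int_root x.
pose s := [seq i <- iota 0 (size C) | C`_i != 0].
have mem_s i : (i \in s) = (C`_i != 0).
  rewrite mem_filter mem_iota add0n /=; case: ltnP => [_|/(nth_default 0)->];
    first by rewrite andbT.
  by rewrite eqxx.
pose t i := (C`_i)%:~R * x ^+ i : algC.
have nzt i : i \in s -> t i != 0.
  by rewrite mem_s => nzCi; rewrite mulf_neq0 ?expf_neq0 ?intr_eq0.
have sum_t : \sum_(i <- s) t i = 0.
  rewrite big_filter -[RHS]Cx (@horner_coef_wide _ (size C)); last first.
    by rewrite size_map_inj_poly //; apply: intr_inj.
  rewrite big_mkcond /= -[iota 0 _](_ : index_iota 0 (size C) = _);
    last by rewrite /index_iota subn0.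
  rewrite big_mkord; apply: eq_bigr => i _; rewrite coef_map /t.
  by case: eqP => //= ->; rewrite mul0r.
have [l sl lmin] : exists2 l, l \in s & forall j, j \in s -> in_local (t j / t l).
  have: s != [::].
    apply/eqP=> s0; move: (mem_s (size C).-1); rewrite s0 in_nil -/(lead_coef C) lead_coef_eq0.
    by rewrite nzC.
  by move: nzt; case: (s) => // i s' nzt _; apply: local_least_divisor.
have s_uniq : uniq s by rewrite filter_uniq ?iota_uniq.
(* Were no other term associated to [t l], dividing the equation by [t l] would put -1 into the
   maximal ideal. *)
have [j [sj jl Ujl]] : exists j, [/\ j \in s, j != l & local_unit (t j / t l)].
  apply: contrapT => noj.
  suff [b [_ nMb]] : in_local_ideal (-1).
    have [_ _ _ M_M _] := M_proper.
    by move=> /(M_M (-1)); rewrite mulrN1 mulrNN mul1r => MM; apply/nMb/MM; rewrite rpredN Aint1.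
  have -> : -1 = \sum_(j <- s | j != l) t j / t l.
    have: \sum_(j <- s) t j / t l = 0 by rewrite -mulr_suml sum_t mul0r.
    rewrite (bigD1_seq l) //= divff ?nzt // => /eqP.
    by rewrite addrC addr_eq0 => /eqP->.
  have [_ M_0 _ _ M_1] := M_proper.
  rewrite big_seq_cond; apply: big_ind.
  - by exists 1; rewrite mulr0 Aint1.
  - exact: in_local_idealD.
  move=> j /andP[sj jl]; have nz : t j / t l != 0 by rewrite mulf_neq0 ?invr_eq0 ?nzt.
  apply: in_local_ideal_nonunit => // [|V']; first exact: lmin.
  by apply: noj; exists j; split=> //; split=> //; apply: lmin.
have [nzCj nzCl] : C`_j != 0 /\ C`_l != 0 by rewrite -!mem_s.
have [ej Uj] := int_local_unit nzCj; have [el Ul] := int_local_unit nzCl.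
have nzj : (C`_j)%:~R != 0 :> algC by rewrite intr_eq0.
have nzl : (C`_l)%:~R != 0 :> algC by rewrite intr_eq0.
have U : local_unit (x ^+ j / x ^+ l * (p%:R ^+ ej / p%:R ^+ el)).
  have -> : x ^+ j / x ^+ l * (p%:R ^+ ej / p%:R ^+ el) =
     t j / t l * ((C`_l)%:~R / p%:R ^+ el) * ((C`_j)%:~R / p%:R ^+ ej)^-1.
    by rewrite /t; field; rewrite ?nzj ?nzl !expf_neq0.
  by apply: local_unitM; [apply: local_unitM | apply: local_unitV].
have pz (e f : nat) : p%:R ^ (- (e%:Z - f%:Z)) = p%:R ^+ f / p%:R ^+ e :> algC.
  by rewrite opprB expfzDr // -exprnN.
case: (ltngtP j l) jl => // [ltjl | ltlj] _; last first.
  exists (j - l)%N, (el%:Z - ej%:Z); split; first by rewrite subn_gt0.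
  rewrite pz; have -> : x ^+ (j - l) = x ^+ j / x ^+ l by rewrite expfB.
  exact: U.
exists (l - j)%N, (ej%:Z - el%:Z); split; first by rewrite subn_gt0.
rewrite pz; have -> : x ^+ (l - j) = x ^+ l / x ^+ j by rewrite expfB.
have -> : x ^+ l / x ^+ j * (p%:R ^+ el / p%:R ^+ ej) = (x ^+ j / x ^+ l * (p%:R ^+ ej / p%:R
  ^+ el))^-1.
  by field; rewrite !expf_neq0.
exact: local_unitV.
Qed.

(** It makes the quotient [a / n] from [local_exponent] well defined, hence usable as the value of
    [v] at [x]. *)
Lemma local_exponent_uniq x n n' (a a' : int) : x != 0 ->
  local_unit (x ^+ n * p%:R ^ (- a)) -> local_unit (x ^+ n' * p%:R ^ (- a')) ->
  a * n' = a' * n.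
Proof.
move=> nzx U U'; have xnn : x ^+ (n * n') != 0 by rewrite expf_neq0.
suff /local_unit_pXz : local_unit (p%:R ^ (a * n' - a' * n)) 
  by move=> /eqP; rewrite subr_eq0 => /eqP.
have -> : p%:R ^ (a * n' - a' * n) =
    (x ^+ n' * p%:R ^ (- a')) ^+ n / (x ^+ n * p%:R ^ (- a)) ^+ n'.
  rewrite !exprMn -!exprM (mulnC n' n) invfM mulrACA divff // mul1r.
  by rewrite -exprVn invr_expz opprK !exprnP !exprz_exp -expfzDr // mulNr addrC.
by apply: local_unitM; [|apply: local_unitV]; apply: local_unitX.
Qed.

Lemma local_valuation_exists : exists v,
  padic_valuation p v /\ forall x, x != 0 -> 0 <= v x -> in_local x.
Proof.
have /choice[v Dv] : forall x, exists q : rat, x != 0 ->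
    exists n (a : int), [/\ (0 < n)%N, local_unit (x ^+ n * p%:R ^ (- a)) & q = a%:~R / n%:R].
  move=> x; have [nzx|_] := boolP (x != 0); last by exists 0.
  have [n [a [n_gt0 U]]] := local_exponent nzx.
  by exists (a%:~R / n%:R) => _; exists n, a.
have vE x n (a : int) : x != 0 -> (0 < n)%N -> local_unit (x ^+ n * p%:R ^ (- a)) ->
    v x = a%:~R / n%:R.
  move=> nzx n_gt0 U; have [n' [a' [n'_gt0 U' ->]]] := Dv x nzx.
  apply/eqP; rewrite eqr_div ?pnatr_eq0 -?lt0n //.
  have /(congr1 (intr : int -> rat)) := local_exponent_uniq nzx U U'.
  by rewrite !intrM => ->.
have vM x y : x != 0 -> y != 0 -> v (x * y) = v x + v y.
  move=> nzx nzy; have [n [a [n_gt0 U ->]]] := Dv x nzx.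
  have [n' [a' [n'_gt0 U' ->]]] := Dv y nzy.
  rewrite (@vE _ (n * n')%N (a * n' + a' * n)).
  - rewrite natrM intrD !intrM -!pmulrn; field.
    by rewrite !pnatr_eq0 -!lt0n n_gt0 n'_gt0.
  - by rewrite mulf_neq0.
  - by rewrite muln_gt0 n_gt0 n'_gt0.
  have -> : (x * y) ^+ (n * n') * p%:R ^ (- (a * n' + a' * n)) =
     (x ^+ n * p%:R ^ (- a)) ^+ n' * (y ^+ n' * p%:R ^ (- a')) ^+ n.
    rewrite !exprMn -!exprM mulrACA (mulnC n' n); congr (_ * _).
    by rewrite !exprnP !exprz_exp opprD expfzDr // !mulNr.
  by apply: local_unitM; apply: local_unitX.
have vp : v p%:R = 1.
  rewrite (@vE _ 1%N 1) // ?divr1 // expr1 -invr_expz expr1z divff //; exact: local_unit1.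
have v1 : v 1 = 0.
  by rewrite (@vE _ 1%N 0) ?mul0r ?oner_eq0 // expr1n mul1r; apply: local_unit1.
have v_ge0 x : x != 0 -> in_local x -> 0 <= v x.
  move=> nzx Vx; have [n [a [n_gt0 [_ V1 V2] ->]]] := Dv x nzx.
  rewrite divr_ge0 ?ler0n // ler0z; apply: in_local_pXz.
  have -> : p%:R ^ a = x ^+ n * (x ^+ n * p%:R ^ (- a))^-1.
    by rewrite invfM invr_expz opprK mulVKf // expf_neq0.
  by apply: in_localM => //; apply: in_localX.
have v_local x : x != 0 -> 0 <= v x -> in_local x.
  move=> nzx vx; have [//|V'] := in_local_total nzx.
  have nzx' : x^-1 != 0 by rewrite invr_eq0.
  have vx' := v_ge0 _ nzx' V'.
  (* Value and opposite value are both nonnegative, so [x ^+ n] is a unit, and [x] is recovered from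
     it by powers of its inverse, which is local. *)
  have vx0 : v x = 0 by have := vM _ _ nzx nzx'; rewrite divff // v1; lra.
  have [n [a [n_gt0 U Da]]] := Dv x nzx.
  have a0 : a = 0.
    apply/eqP; move: vx0 => /eqP; rewrite Da mulf_eq0 invr_eq0 pnatr_eq0 -[n == 0%N]negbK -lt0n
      n_gt0 orbF.
    by rewrite intr_eq0.
  move: U; rewrite a0 mulr1 => -[_ Vn _].
  have -> : x = x ^+ n * x^-1 ^+ n.-1.
    by rewrite -{1}(prednK n_gt0) exprS exprVn mulfK // expf_neq0.
  by apply: in_localM => //; apply: in_localX.
exists v; split=> //; split=> // [x y nzx nzy nzxy | x Ax nzx]; last first.
  by apply: v_ge0 => //; apply: in_local_Aint.
wlog vle : x y nzx nzy nzxy / v x <= v y.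
  move=> IH; have /orP[vxy | vxy] := le_total (v x) (v y); first exact: IH.
  by have := IH y x nzy nzx; rewrite addrC [Num.min (v y) _]minC; apply.
have Dxy : x + y = x * (1 + y / x) by field.
have nz1 : 1 + y / x != 0 by apply: contraNneq nzxy => D0; rewrite Dxy D0 mulr0.
rewrite min_l // Dxy vM // lerDl; apply: v_ge0 => //.
apply: in_localD; first by apply: in_local_Aint; rewrite Aint1.
have nzyx : y / x != 0 by rewrite mulf_neq0 ?invr_eq0.
apply: v_local => //; have := vM _ _ nzyx nzx; rewrite divfK //; lra.
Qed.

End LocalRing.

(** The second conclusion refers back to [I]: with the ideal of denominators of a number as [I], it
    becomes a criterion of integrality. *)
Lemma valuation_exists (p : nat) (I : algC -> Prop) :
  prime p -> proper_ideal I -> I p%:R -> exists2 v, padic_valuation p v &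
  forall x, x != 0 -> 0 <= v x -> exists b, [/\ b \in Aint, ~ I b & b * x \in Aint].
Proof.
move=> p_pr I_proper Ip; have [M [M_proper sIM M_max]] := maximal_ideal_exists I_proper.
have [v [val_v v_loc]] := local_valuation_exists p_pr M_proper (sIM _ Ip) M_max.
exists v => // x nzx /(v_loc x nzx)[b [Ab nMb Abx]]; exists b; split=> // /sIM; exact: nMb.
Qed.

(* If the denominators of [x] formed a proper ideal, that ideal would lie over
   [p], and [x] would be integral at some place above it. *)
Lemma Aint_of_valuations (p e : nat) (x : algC) : prime p -> p%:R ^+ e * x \in Aint ->
  (forall v, padic_valuation p v -> x != 0 -> 0 <= v x) -> x \in Aint.
Proof.
move=> p_pr Apx vx; have [-> | nzx] := eqVneq x 0; first by rewrite Aint0.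
elim: e => [|e IHe] in x Apx vx nzx *; first by rewrite expr0 mul1r in Apx.
have nzp : p%:R != 0 :> algC by rewrite pnatr_eq0 -lt0n prime_gt0.
(* Once [p x] is integral, [p] is a denominator of [x], so every place above the ideal of
   denominators lies over [p]. *)
suff Ax : p%:R * x \in Aint.
  apply: contrapT => nAx.
  have [||v val_v /(_ x nzx)] := @valuation_exists p (fun b => b \in Aint /\ b * x \in Aint) p_pr.
  - split=> [b [] // | | b c [Ab Abx] [Ac Acx] | a b Aa [Ab Abx] | [_]].
    + by rewrite mul0r Aint0.
    + by rewrite mulrDl !rpredD.
    + by split; rewrite -?mulrA; apply: rpredM.
    + by rewrite mul1r.
  - by split=> //; apply: (Aint_int p).
  by case=> [|b [Ab nIb Abx]]; [apply: vx | apply: nIb].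
apply: IHe; rewrite ?mulf_neq0 //; first by rewrite mulrA -exprSr.
move=> v val_v _; have [vM _ vp _] := val_v.
by rewrite vM // vp addr_ge0 // vx.
Qed.

(** * Calculus with a fixed valuation; roots of unity *)

Section Valuation.

Variables (p : nat) (v : algC -> rat).
Hypotheses (p_pr : prime p) (val_v : padic_valuation p v).

Lemma pvalM x y : x != 0 -> y != 0 -> v (x * y) = v x + v y.
Proof. by have [vM _ _ _] := val_v; apply: vM. Qed.

Lemma pvalp : v p%:R = 1.
Proof. by have [_ _ vp _] := val_v. Qed.

Lemma val_Aint x : x \in Aint -> x != 0 -> 0 <= v x.
Proof. by have [_ _ _ vA] := val_v; apply: vA. Qed.

Lemma pval1 : v 1 = 0.
Proof. by have := pvalM (oner_neq0 _) (oner_neq0 algC); rewrite mulr1; lra. Qed.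

Lemma pvalX x n : x != 0 -> v (x ^+ n) = v x * n%:R.
Proof.
move=> nzx; elim: n => [|n IHn]; first by rewrite pval1 mulr0.
by rewrite exprS pvalM ?expf_neq0 // IHn -natr1; ring.
Qed.

Lemma pvalV x : x != 0 -> v x^-1 = - v x.
Proof.
move=> nzx; have nzx' : x^-1 != 0 by rewrite invr_eq0.
by have := pvalM nzx nzx'; rewrite divff // pval1; lra.
Qed.

Lemma val_unity_root x n : (0 < n)%N -> x ^+ n = 1 -> v x = 0.
Proof.
move=> n_gt0 xn1; have nzx : x != 0.
  by apply: contra_eq_neq xn1 => ->; rewrite expr0n gtn_eqF // eq_sym oner_eq0.
have /eqP := pvalX n nzx; rewrite xn1 pval1 eq_sym mulf_eq0 pnatr_eq0 (gtn_eqF n_gt0) orbF.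
by move/eqP.
Qed.

Lemma pvalN x : x != 0 -> v (- x) = v x.
Proof.
move=> nzx; rewrite -mulN1r pvalM ?oppr_eq0 ?oner_eq0 //.
by rewrite (@val_unity_root (-1) 2) ?add0r // sqrrN expr1n.
Qed.

Lemma val_prod (I : eqType) (r : seq I) (F : I -> algC) :
  (forall i, i \in r -> F i != 0) -> v (\prod_(i <- r) F i) = \sum_(i <- r) v (F i).
Proof.
elim: r => [|i r IHr] nzF; first by rewrite !big_nil pval1.
have nzF' j : j \in r -> F j != 0 by move=> rj; rewrite nzF // inE rj orbT.
rewrite !big_cons pvalM ?IHr //; first by rewrite nzF ?mem_head.
by rewrite prodf_seq_neq0; apply/allP=> j /nzF'->; rewrite implybT.
Qed.

(** Nothing is known about [v 0]; this predicate gives 0 infinite valuation, so that sums can be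
    estimated without nonvanishing conditions. *)
Definition val_gt (t : rat) (x : algC) : bool := (x == 0) || (t < v x).

Lemma val_gt0 t : val_gt t 0.
Proof. by rewrite /val_gt eqxx. Qed.

Lemma val_gtD t x y : val_gt t x -> val_gt t y -> val_gt t (x + y).
Proof.
rewrite /val_gt => /orP[/eqP-> | vx]; first by rewrite add0r.
move=> /orP[/eqP-> | vy]; first by rewrite addr0 vx orbT.
have [-> | nzx] := eqVneq x 0; first by rewrite add0r vy orbT.
have [-> | nzy] := eqVneq y 0; first by rewrite addr0 vx orbT.
have [// | nzxy] := eqVneq (x + y) 0.
have [_ vD _ _] := val_v; apply: lt_le_trans (vD _ _ nzx nzy nzxy).
by rewrite lt_min vx.
Qed.

Lemma val_gt_sum t (I : finType) (P : pred I) (F : I -> algC) :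
  (forall i, P i -> val_gt t (F i)) -> val_gt t (\sum_(i | P i) F i).
Proof. by move=> gtF; apply: (big_ind (val_gt t)) => //; [apply: val_gt0 | apply: val_gtD]. Qed.

Lemma val_gtM t x y : x \in Aint -> val_gt t y -> val_gt t (x * y).
Proof.
rewrite /val_gt => Ax /orP[/eqP-> | vy]; first by rewrite mulr0 eqxx.
have [-> | nzx] := eqVneq x 0; first by rewrite mul0r eqxx.
have [-> | nzy] := eqVneq y 0; first by rewrite mulr0 eqxx.
rewrite pvalM // mulf_eq0 (negPf nzx) (negPf nzy) /=.
by have := val_Aint Ax nzx; lra.
Qed.

Lemma val_add_gt x y : x != 0 -> val_gt (v x) y -> x + y != 0 /\ v (x + y) = v x.
Proof.
move=> nzx /orP[/eqP-> | vy]; first by rewrite addr0.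
have nzxy : x + y != 0.
  apply: contraTneq vy => /eqP; rewrite addr_eq0 => /eqP Dx.
  by rewrite -leNgt Dx pvalN ?lexx // -oppr_eq0 -Dx.
split=> //; have [y0 | nzy] := eqVneq y 0; first by rewrite y0 addr0.
have [_ vD _ _] := val_v; have := vD _ _ nzx nzy nzxy; rewrite min_l ?(ltW vy) // => le1.
apply: le_anti; rewrite le1 andbT.
have nzy' : - y != 0 by rewrite oppr_eq0.
have := vD _ _ nzxy nzy'; rewrite addrK pvalN // => /(_ nzx).
by rewrite ge_min [v y <= _]leNgt vy orbF.
Qed.

Lemma val_nat (n : nat) : (0 < n)%N -> v n%:R = (logn p n)%:R.
Proof.
move=> n_gt0; have [m cop Dn] := pfactor_coprime p_pr n_gt0.
have m_gt0 : (0 < m)%N by move: n_gt0; rewrite Dn muln_gt0 => /andP[].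
have nz k : (0 < k)%N -> k%:R != 0 :> algC by rewrite pnatr_eq0 lt0n.
have nzp := nz p (prime_gt0 p_pr).
rewrite {1}Dn natrM natrX pvalM ?pvalX ?pvalp ?mul1r ?expf_neq0 ?(nz m) //.
suff -> : v m%:R = 0 by rewrite add0r.
apply: le_anti; rewrite val_Aint ?nz ?andbT //; last exact: (Aint_int m).
rewrite leNgt; apply/negP => vm.
(* Otherwise a Bezout relation would write 1 with two terms of positive valuation. *)
have [[a b] /= Dab] := coprimeP m (prime_gt0 p_pr) cop.
have D1 : 1 = a%:R * p%:R + - b%:R * m%:R :> algC.
  by rewrite -natrM; have -> : (a * p = b * m + 1)%N; [lia | rewrite natrD natrM; ring].
suff : val_gt 0 1 by rewrite /val_gt oner_eq0 pval1 ltxx.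
rewrite D1; apply: val_gtD; apply: val_gtM.
- exact: (Aint_int a).
- by rewrite /val_gt pvalp orbT.
- by rewrite rpredN (Aint_int b).
- by rewrite /val_gt vm orbT.
Qed.

Lemma val_int (c : int) : c != 0 -> v c%:~R = (logn p `|c|)%:R.
Proof.
move=> nzc; rewrite -val_nat ?absz_gt0 //.
have -> : c%:~R = (-1) ^+ (c < 0)%R * `|c|%N%:R :> algC by rewrite [c in LHS]intEsign intrM
  rmorph_sign.
rewrite pvalM ?signr_eq0 ?pnatr_eq0 ?absz_eq0 //.
by rewrite (@val_unity_root _ 2) ?add0r // -exprM mulnC exprM sqrrN expr1n expr1n.
Qed.

Lemma val_rat (c : rat) : c != 0 ->
  v (ratr c) = (logn p `|numq c|)%:R - (logn p `|denq c|)%:R.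
Proof.
move=> nzc; have nzn : numq c != 0 by rewrite numq_eq0.
have nzd : denq c != 0 by rewrite denq_eq0.
rewrite -{1}(divq_num_den c) rmorphM fmorphV /= !ratr_int.
by rewrite pvalM ?pvalV ?val_int ?invr_eq0 ?intr_eq0.
Qed.

(** Each root is a power of the other, so [1 - z] and [1 - y] divide each other through geometric
    sums. *)
Lemma val_prim_root n (z y : algC) : n.-primitive_root z -> n.-primitive_root y -> (1 < n)%N ->
  v (1 - z) = v (1 - y).
Proof.
move=> prz pry n_gt1.
wlog suff le_zy : z y prz pry / v (1 - z) <= v (1 - y).
  by apply: le_anti; rewrite !le_zy.
have [i Dy] := prim_rootP prz (prim_expr_order pry).
have nz1 (x : algC) : n.-primitive_root x -> 1 - x != 0.
  by move=> prx; rewrite subr_eq0 eq_sym -[x]expr1 -(prim_order_dvd prx) gtnNdvd.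
have D1 : 1 - y = (1 - z) * \sum_(j < i) z ^+ j by rewrite Dy -opprB subrX1; ring.
have nzs : \sum_(j < i) z ^+ j != 0.
  by apply/eqP=> s0; have := nz1 y pry; rewrite D1 s0 mulr0 eqxx.
rewrite D1 pvalM ?nz1 // lerDl val_Aint // rpred_sum // => j _.
by rewrite rpredX // (Aint_prim_root prz).
Qed.

Lemma prod_sub_prim_root n (z x y : algC) : n.-primitive_root z ->
  \prod_(0 <= i < n) (x - z ^+ i * y) = x ^+ n - y ^+ n.
Proof.
move=> prz; have n_gt0 := prim_order_gt0 prz.
have [-> | nzy] := eqVneq y 0.
  rewrite expr0n gtn_eqF // subr0; under eq_bigr do rewrite mulr0 subr0.
  by rewrite big_const_nat subn0 iter_mulr mulr1.
have := congr1 (fun P => P.[x / y] * y ^+ n) (factor_Xn_sub_1 prz).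
rewrite horner_prod hornerD hornerN hornerC hornerXn mulrBl mul1r expr_div_n divfK ?expf_neq0
  // => <-.
rewrite -[n in y ^+ n]subn0 -prodr_const_nat -big_split /=.
by apply: eq_bigr => i _; rewrite hornerXsubC mulrBl divfK.
Qed.

(** Both sides are the value at 1 of (X^n - 1) / (X - 1). *)
Lemma prod_1sub_prim_root n (z : algC) : n.-primitive_root z ->
  \prod_(1 <= i < n) (1 - z ^+ i) = n%:R.
Proof.
move=> prz; have n_gt0 := prim_order_gt0 prz.
have nzX1 : 'X - 1%:P != 0 :> {poly algC} by rewrite polyXsubC_eq0.
have := factor_Xn_sub_1 prz; rewrite subrX1 big_ltn // expr0 => /(mulfI nzX1).
move/(congr1 (fun P => P.[1])); rewrite horner_prod horner_sum.
under eq_bigr do rewrite hornerXsubC; move=> ->.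
under eq_bigr do rewrite hornerXn expr1n.
by rewrite sumr_const card_ord.
Qed.

(** For order [p], the [p - 1] factors of equal valuation multiply to [p]. At each further level,
    the [p] numbers 1 - w z, with [w] a [p]-th root of unity, have equal valuation and multiply to 1
    - z^p. *)
Lemma val_1sub_prim_root a z : (p ^ a.+1).-primitive_root z ->
  v (1 - z) = (p.-1 * p ^ a)%:R^-1.
Proof.
have p_gt1 := prime_gt1 p_pr.
elim: a z => [|a IHa] z prz.
  rewrite expn1 in prz; rewrite expn0 muln1.
  have nz i : i \in index_iota 1 p -> 1 - z ^+ i != 0.
    rewrite mem_index_iota => /andP[i_gt0 ltip].
    by rewrite subr_eq0 eq_sym -(prim_order_dvd prz) gtnNdvd.
  have := congr1 v (prod_1sub_prim_root prz); rewrite val_prod // pvalp.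
  rewrite (eq_big_seq (fun=> v (1 - z))) => [|i].
    rewrite sumr_const_nat subn1 => Dv.
    apply: (mulIf (_ : p.-1%:R != 0)); first by rewrite pnatr_eq0 -lt0n -subn1 subn_gt0.
    rewrite mulVf ?mulr_natr // pnatr_eq0 -lt0n -subn1 subn_gt0 //.
  rewrite mem_index_iota => /andP[i_gt0 ltip].
  apply: (@val_prim_root p) => //; rewrite prim_root_exp_coprime //.
  by rewrite coprime_sym prime_coprime // gtnNdvd.
have p_gt0 := prime_gt0 p_pr; have n_gt1 : (1 < p ^ a.+2)%N by rewrite (ltn_exp2l 0).
have dvdp e f : (e <= f)%N -> (p ^ e %| p ^ f)%N by apply: dvdn_exp2l.
have prw := dvdn_prim_root prz (dvdp 1%N a.+2 isT).
have prz' := dvdn_prim_root prz (dvdp a.+1 a.+2 (leqnSn _)).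
rewrite -expnB // subSnn expn1 in prz'.
(* The factor is a power of [z] with exponent 1 modulo [p ^ a.+1], hence prime to [p]. *)
have prwz i : (p ^ a.+2).-primitive_root (z ^+ (p ^ a.+2 %/ p ^ 1) ^+ i * z).
  rewrite -exprM -exprSr prim_root_exp_coprime // coprime_pexpr // coprime_sym prime_coprime //.
  rewrite -expnB // subn1 expnS -mulnA -addn1 dvdn_addr ?dvdn_mulr //.
  by rewrite dvdn1 gtn_eqF.
have nz i : 1 - z ^+ (p ^ a.+2 %/ p ^ 1) ^+ i * z != 0.
  by rewrite subr_eq0 eq_sym -[X in X == 1]expr1 -(prim_order_dvd (prwz i)) gtnNdvd.
rewrite expn1 in prw nz prwz.
have := congr1 v (prod_sub_prim_root 1 z prw); rewrite expr1n val_prod // (IHa _ prz').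
under eq_bigr do rewrite (val_prim_root (prwz _) prz n_gt1).
rewrite sumr_const_nat subn0 => Dv.
have nzp : p%:R != 0 :> rat by rewrite pnatr_eq0 gtn_eqF.
by apply: (mulIf nzp); rewrite mulr_natr Dv expnS mulnCA (natrM _ p) invfM [RHS]mulrC mulVKf.
Qed.

End Valuation.

(** * Distances between the conjugates of a radical *)

Lemma prim_rootV_expr n (z : algC) i : n.-primitive_root z -> coprime i n ->
  n.-primitive_root (z ^- i).
Proof.
move=> prz cop; have n_gt0 := prim_order_gt0 prz.
have zi1 : (z ^- i) ^+ n = 1 by rewrite exprVn -exprM mulnC exprM (prim_expr_order prz) expr1n
  invr1.
have [j Dj] := prim_rootP prz zi1.
rewrite Dj prim_root_exp_coprime //.
have nzz : z != 0 by rewrite (prim_root_eq0 prz) -lt0n.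
have : z ^+ (i + j) == z ^+ 0 by rewrite exprD -Dj divff // expf_neq0.
rewrite (eq_prim_root_expr prz) mod0n => dvd_n.
have {}dvd_n : (n %| i + j)%N by [].
rewrite /coprime -dvdn1 -(eqnP cop) dvdn_gcd dvdn_gcdr andbT.
by rewrite -(dvdn_addl _ (dvdn_gcdl j n)) (dvdn_trans (dvdn_gcdr j n)).
Qed.

(** [y] is a power of [u] with exponent divisible by [p]; one more factor [u] makes the exponent
    prime to [p]. *)
Lemma prim_root_mul_small p a (u y : algC) : prime p -> (p ^ a.+1).-primitive_root u ->
  y ^+ (p ^ a) = 1 -> (p ^ a.+1).-primitive_root (y * u).
Proof.
move=> p_pr pru y1; have p_gt0 := prime_gt0 p_pr.
have [j Dj] : exists j : nat, y = u ^+ j.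
  have [|j ->] := @prim_rootP _ _ _ pru y; last by exists j.
  by rewrite expnSr exprM y1 expr1n.
have dvd_pj : (p %| j)%N.
  move/eqP: y1; rewrite Dj -exprM -(prim_order_dvd pru) expnS.
  by rewrite dvdn_pmul2r ?expn_gt0 ?p_gt0.
rewrite Dj.
rewrite -exprSr prim_root_exp_coprime // coprime_pexpr // coprime_sym prime_coprime //.
by rewrite -addn1 dvdn_addr // dvdn1 gtn_eqF ?prime_gt1.
Qed.

Section Places.

Variables (p : nat) (v : algC -> rat).
Hypotheses (p_pr : prime p) (val_v : padic_valuation p v).

(* Among the conjugates [x] of [beta], the one closest to [d] satisfies the
   ultrametric equality in all isosceles triangles [d], [x], [u * x]. *)
Lemma closest_root_exists N (z beta d : algC) : N.-primitive_root z ->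
  v beta = 0 -> beta != 0 -> beta ^+ N != d ^+ N ->
  exists2 x, x ^+ N = beta ^+ N & forall u : algC, u ^+ N = 1 -> u != 1 ->
    v (u * x - d) = Num.min (v (1 - u)) (v (x - d)).
Proof.
move=> prz vb nzb neq_bd; have N_gt0 := prim_order_gt0 prz.
pose i0 : 'I_N := Ordinal N_gt0.
have [i _ maxi] := @arg_maxP _ _ _ i0 predT (fun i : 'I_N => v (beta * z ^+ i - d)) isT.
set x := beta * z ^+ i.
have xN : x ^+ N = beta ^+ N.
  by rewrite exprMn -exprM mulnC exprM (prim_expr_order prz) expr1n mulr1.
exists x => // u uN u1.
have nzd y : y ^+ N = beta ^+ N -> y - d != 0.
  by move=> yN; apply: contra_neq neq_bd => /eqP; rewrite subr_eq0 -yN => /eqP->.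
have nzx : x != 0.
  by rewrite mulf_neq0 // expf_neq0 // (prim_root_eq0 prz) -lt0n.
have vx : v x = 0.
  rewrite (pvalM val_v) // ?expf_neq0 ?(prim_root_eq0 prz) -?lt0n // vb add0r.
  by rewrite (@val_unity_root _ _ val_v _ N) // -exprM mulnC exprM (prim_expr_order prz) expr1n.
have uxN : (u * x) ^+ N = beta ^+ N by rewrite exprMn uN mul1r.
have max_u : v (u * x - d) <= v (x - d).
  have [j Du] := prim_rootP prz uN; pose l : 'I_N := Ordinal (ltn_pmod (i + j) N_gt0).
  have -> : u * x = beta * z ^+ l by rewrite /= (prim_expr_mod prz) Du exprD /x; ring.
  exact: maxi.
have nzux : (u - 1) * x != 0 by rewrite mulf_neq0 // subr_eq0.
have vux : v ((u - 1) * x) = v (1 - u).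
  by rewrite (pvalM val_v) // ?subr_eq0 // vx addr0 -opprB (pvalN val_v) // subr_eq0 eq_sym.
have D1 : u * x - d = (u - 1) * x + (x - d) by ring.
have D2 : u * x - d = (x - d) + (u - 1) * x by ring.
have nzxd := nzd x xN.
(* Distinct valuations give the minimum. In case of equality the ultrametric inequality only bounds
   from below, and the maximality of [v (x - d)] bounds from above. *)
have [lt_v | lt_v | eq_v] := ltgtP (v (1 - u)) (v (x - d)).
- rewrite D1; have [|_ ->] // := @val_add_gt _ _ val_v _ (x - d) nzux.
  by rewrite /val_gt vux lt_v orbT.
- rewrite D2; have [|_ ->] // := @val_add_gt _ _ val_v _ ((u - 1) * x) nzxd.
  by rewrite /val_gt vux lt_v orbT.
apply: le_anti; rewrite eq_v max_u D1.
have [_ vD _ _] := val_v; have := vD _ _ nzux nzxd.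
by rewrite vux eq_v minxx -D1; apply; apply: nzd.
Qed.

Variables (k : nat) (z x d : algC).
Hypothesis prz : (p ^ k).-primitive_root z.
Hypothesis neq_xd : x ^+ (p ^ k) != d ^+ (p ^ k).
Hypothesis v_isosceles : forall u : algC, u ^+ (p ^ k) = 1 -> u != 1 ->
  v (u * x - d) = Num.min (v (1 - u)) (v (x - d)).

Let mu := v (x - d).

Let p_gt0 : (0 < p)%N := prime_gt0 p_pr.

Lemma conj_sub_neq0 (u : algC) b : u ^+ (p ^ k) = 1 -> (b <= k)%N ->
  (u * x) ^+ (p ^ b) - d ^+ (p ^ b) != 0.
Proof.
move=> u1 lebk; apply: contra_neq neq_xd => /eqP; rewrite subr_eq0 => /eqP Dux.
rewrite -[LHS]mul1r -u1 -exprMn -(subnKC lebk) expnD !exprM Dux.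
by rewrite -!exprM.
Qed.

Lemma unity_prim_root a (u : algC) : (a <= k)%N -> (p ^ a).-primitive_root u -> u ^+ (p ^ k) = 1.
Proof.
by move=> leak pru; rewrite -(subnKC leak) expnD exprM (prim_expr_order pru) expr1n.
Qed.

Lemma val_conj_sub a (u : algC) : (a < k)%N -> (p ^ a.+1).-primitive_root u ->
  v (u * x - d) = Num.min (p.-1 * p ^ a)%:R^-1 mu.
Proof.
move=> ltak pru; rewrite v_isosceles ?(unity_prim_root ltak) //.
  by rewrite (val_1sub_prim_root p_pr val_v pru).
by rewrite -[u]expr1 -(prim_order_dvd pru) gtnNdvd // (ltn_exp2l 0) ?prime_gt1.
Qed.

(** Up to a root of unity, each of the [p ^ b] linear factors is w' u x - d, where w' u still has
    order [p ^ a.+1] because [b <= a]; so all have the same valuation. *)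
Lemma val_conj_expn_sub a b (u : algC) : (b <= a < k)%N -> (p ^ a.+1).-primitive_root u ->
  v ((u * x) ^+ (p ^ b) - d ^+ (p ^ b)) = (p ^ b)%:R * Num.min (p.-1 * p ^ a)%:R^-1 mu.
Proof.
move=> /andP[leba ltak] pru.
have lebk : (b <= k)%N by apply: leq_trans leba (ltnW ltak).
have prw := dvdn_prim_root prz (dvdn_exp2l p lebk); set w := z ^+ _ in prw; clearbody w.
have nzw : w != 0 by rewrite (prim_root_eq0 prw) -lt0n expn_gt0 p_gt0.
have prwu i : (p ^ a.+1).-primitive_root (w ^- i * u).
  apply: prim_root_mul_small => //; rewrite exprVn -exprM mulnC exprM.
  by rewrite -(subnKC leba) expnD exprM (prim_expr_order prw) !expr1n invr1.
have vw i : v (w ^+ i) = 0.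
  by rewrite (@val_unity_root _ _ val_v _ (p ^ b)) ?expn_gt0 ?p_gt0 // -exprM mulnC exprM
    (prim_expr_order prw) expr1n.
have Dfac i : u * x - w ^+ i * d = w ^+ i * (w ^- i * u * x - d).
  by rewrite mulrBr -!mulrA mulVKf // expf_neq0.
have nzfac i : w ^- i * u * x - d != 0.
  have := @conj_sub_neq0 (w ^- i * u) 0 _ (leq0n k); rewrite !expn0 !expr1; apply.
  exact: unity_prim_root (prwu i).
rewrite -(prod_sub_prim_root _ _ prw) (val_prod val_v) // => [|i _]; last first.
  by rewrite Dfac mulf_neq0 // expf_neq0.
have vfac i : v (u * x - w ^+ i * d) = Num.min (p.-1 * p ^ a)%:R^-1 mu.
  rewrite Dfac (pvalM val_v) // ?expf_neq0 //.
  by rewrite vw add0r (val_conj_sub ltak (prwu _)).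
rewrite (eq_bigr _ (fun i _ => vfac i)).
by rewrite sumr_const_nat subn0 mulr_natl.
Qed.

(** Among the linear factors for [b.+1], exponents divisible by [p] reproduce those for [b]; the
    remaining (p - 1) p^b belong to primitive roots of order [p ^ b.+1]. *)
Lemma val_expn_sub_rec b : (b < k)%N ->
  v (x ^+ (p ^ b.+1) - d ^+ (p ^ b.+1)) =
  v (x ^+ (p ^ b) - d ^+ (p ^ b)) + (p.-1 * p ^ b)%:R * Num.min (p.-1 * p ^ b)%:R^-1 mu.
Proof.
move=> ltbk; have p_gt1 := prime_gt1 p_pr.
have prw := dvdn_prim_root prz (dvdn_exp2l p ltbk); set w := z ^+ _ in prw; clearbody w.
have nzw : w != 0 by rewrite (prim_root_eq0 prw) -lt0n expn_gt0 p_gt0.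
have prwp : (p ^ b).-primitive_root (w ^+ p).
  have := dvdn_prim_root prw (dvdn_exp2l p (leqnSn b)).
  by rewrite -expnB // subSnn expn1.
have w1 i : (w ^- i) ^+ (p ^ k) = 1.
  rewrite exprVn -exprM mulnC exprM -(subnKC ltbk) expnD exprM (prim_expr_order prw).
  by rewrite !expr1n invr1.
have vw i : v (w ^+ i) = 0.
  by apply: (@val_unity_root _ _ val_v _ (p ^ b.+1));
    rewrite ?expn_gt0 ?p_gt0 // -exprM mulnC exprM (prim_expr_order prw) expr1n.
have Dfac i : x - w ^+ i * d = w ^+ i * (w ^- i * x - d).
  by rewrite mulrBr mulVKf // expf_neq0.
have nzfac i : w ^- i * x - d != 0.
  by have := conj_sub_neq0 (w1 i) (leq0n k); rewrite !expn0 !expr1.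
have nzfac' i : x - w ^+ i * d != 0 by rewrite Dfac mulf_neq0 // expf_neq0.
have vfac i : ~~ (p %| i)%N -> v (x - w ^+ i * d) = Num.min (p.-1 * p ^ b)%:R^-1 mu.
  move=> ndvd; rewrite Dfac (pvalM val_v) ?expf_neq0 // vw add0r; apply: val_conj_sub => //.
  by apply: prim_rootV_expr => //; rewrite coprime_sym coprime_pexpl // prime_coprime.
rewrite -(prod_sub_prim_root _ _ prw) -(prod_sub_prim_root _ _ prwp) !(val_prod val_v) //;
  last first.
  by move=> i _; rewrite -exprM.
rewrite expnSr big_nat_mul.
have Drow i : \sum_(i * p <= j < i.+1 * p) v (x - w ^+ j * d) =
    v (x - w ^+ p ^+ i * d) + Num.min (p.-1 * p ^ b)%:R^-1 mu *+ p.-1.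
  rewrite big_ltn ?ltn_pmul2r // -exprM (mulnC p i).
  congr (_ + _); rewrite (@eq_big_nat _ _ _ _ _ _ (fun=> Num.min (p.-1 * p ^ b)%:R^-1 mu)).
    by rewrite sumr_const_nat; congr (_ *+ _); rewrite mulSn subnS addnK.
  move=> j /andP[ltj jlt]; apply: vfac; apply/negP=> /dvdnP[q Dq].
  move: ltj jlt; rewrite Dq ltn_pmul2r // ltn_pmul2r // ltnS.
  by move=> lt1 lt2; have := leq_ltn_trans lt2 lt1; rewrite ltnn.
rewrite (eq_bigr _ (fun i _ => Drow i)) big_split /=; congr (_ + _).
by rewrite sumr_const_nat subn0 -mulrnA mulr_natl.
Qed.

End Places.

(** Here [F b] stands for v(x^(p^b) - d^(p^b)) and [mu] for v(x - d), with [x] the closest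
    conjugate. The last conclusion says that [mu] is the inverse of [p ^ (k - s)], except when
    [k - s = 0]: then only [e = 0] is left, and [mu] may be larger. *)
Lemma closest_root_recursion (p k s : nat) (F : nat -> rat) (mu : rat) :
  (1 < p)%N -> F 0 = mu ->
  (forall b, (b < k)%N -> F b.+1 = F b + (p.-1 * p ^ b)%:R * Num.min (p.-1 * p ^ b)%:R^-1 mu) ->
  F k = s%:R + 1 ->
  [/\ forall b, (k - s <= b <= k)%N -> F b = s%:R + 1 - (k - b)%:R,
      1 <= (p ^ (k - s))%:R * mu &
      forall e, (e < p ^ (k - s))%N -> e%:R * mu = e%:R / (p ^ (k - s))%:R].
Proof.
move=> p_gt1 F0 Frec Fk; set b0 := (k - s)%N.
have p_gt0 : (0 < p)%N := ltnW p_gt1.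
have phi_gt0 b : 0 < (p.-1 * p ^ b)%:R :> rat.
  by rewrite ltr0n muln_gt0 expn_gt0 p_gt0 andbT -subn1 subn_gt0.
have {}Frec b : (b < k)%N -> F b.+1 = F b + Num.min 1 ((p.-1 * p ^ b)%:R * mu).
  by move=> ltbk; rewrite Frec // minr_pMr ?ltW // mulfV // lt0r_neq0.
have phiS b : (p ^ b.+1)%:R = (p ^ b)%:R + (p.-1 * p ^ b)%:R :> rat.
  by rewrite -natrD -mulSn prednK // expnS.
have F_le b : (b <= k)%N -> F b <= (p ^ b)%:R * mu.
  elim: b => [|b IHb] ltbk; first by rewrite F0 expn0 mul1r.
  rewrite Frec // phiS mulrDl; have := IHb (ltnW ltbk).
  by case: (leP 1 ((p.-1 * p ^ b)%:R * mu)); lra.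
have F_add b c : (b + c <= k)%N -> F (b + c)%N <= F b + c%:R.
  elim: c => [|c IHc] lek; first by rewrite addn0 addr0.
  rewrite addnS in lek *; rewrite Frec // -natr1; have := IHc (ltnW lek).
  by case: (leP 1 ((p.-1 * p ^ (b + c))%:R * mu)); lra.
have le_b0k : (b0 <= k)%N by exact: leq_subr.
(* Increments are at most 1, so [F b0] is at least 1; they are also at most (p^(b+1) - p^b) mu,
   which telescopes to [F b0 <= p ^ b0 * mu]. *)
have mu_b0 : 1 <= (p ^ b0)%:R * mu.
  have := F_add b0 (k - b0)%N; rewrite subnKC // leqnn Fk => /(_ isT).
  have : (k - b0)%:R <= s%:R :> rat by rewrite ler_nat /b0; lia.
  by have := F_le b0 le_b0k; lra.
have mu_gt0 : 0 < mu.
  by rewrite -(@pmulr_rgt0 _ (p ^ b0)%:R) ?ltr0n ?expn_gt0 ?p_gt0 //; lra.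
have F_lin b : (b0 <= b)%N -> (b < k)%N -> F b.+1 = F b + 1.
  move=> leb0b ltbk; rewrite Frec // min_l //; apply: le_trans mu_b0 _.
  rewrite ler_pM2r // ler_nat; apply: leq_trans (leq_pexp2l p_gt0 leb0b) _.
  by apply: leq_pmull; rewrite -subn1 subn_gt0.
have F_b b : (b0 <= b <= k)%N -> F b = s%:R + 1 - (k - b)%:R.
  move=> /andP[leb0b lebk]; have Dk : F (b + (k - b))%N = F b + (k - b)%:R; last first.
    by move: Dk; rewrite subnKC // Fk; lra.
  have: (b + (k - b) <= k)%N by rewrite subnKC.
  elim: (k - b)%N => [|c IHc] lek; first by rewrite addn0 addr0.
  rewrite addnS in lek *; rewrite (F_lin _ (leq_trans leb0b (leq_addr _ _)) lek).
  by rewrite (IHc (ltnW lek)) -natr1 addrA.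
split=> // e lt_e; have [lt0b0 | ] := ltnP 0 b0; last first.
  by rewrite leqn0 => /eqP b00; move: lt_e; rewrite b00 expn0 ltnS leqn0 => /eqP->;
    rewrite !mul0r.
suff -> : mu = (p ^ b0)%:R^-1 by [].
(* An increment truncated to 1 pushes [F] beyond 1 for good, whereas [F b0 = 1] when [b0 > 0]; so no
   truncation happens up to [b0]. *)
have F_alt b : (b <= b0)%N -> F b = (p ^ b)%:R * mu \/ 1 < F b.
  elim: b => [|b IHb] lebb0; first by left; rewrite F0 expn0 mul1r.
  have ltbk : (b < k)%N by apply: leq_trans lebb0 le_b0k.
  have phimu : 0 < (p.-1 * p ^ b)%:R * mu by rewrite mulr_gt0.
  have pmu : 0 < (p ^ b)%:R * mu by rewrite mulr_gt0 // ltr0n expn_gt0 p_gt0.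
  rewrite Frec // phiS mulrDl.
  have [IH | IH] := IHb (ltnW lebb0);
    case: (leP 1 ((p.-1 * p ^ b)%:R * mu)) => ?; try (by right; lra).
  by left; lra.
have := F_b b0; rewrite leqnn le_b0k => /(_ isT).
have -> : (k - b0 = s)%N by rewrite /b0; lia.
have [-> | ? ?] := F_alt b0 (leqnn _); last lra.
rewrite addrAC subrr add0r => Dmu; have nz : (p ^ b0)%:R != 0 :> rat by rewrite pnatr_eq0 -lt0n
  expn_gt0 p_gt0.
by apply: (mulfI nz); rewrite Dmu mulfV.
Qed.

(** Horizontal length of the side [b] of the Newton polygon, that is, the number of conjugates on
    it; every [b <= b0] denotes the first side. *)
Definition slope_length (p b0 b : nat) : nat :=
  if (b <= b0)%N then (p ^ b0)%N else (p.-1 * p ^ b.-1)%N.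

Lemma slope_length_gt0 p b0 b : (1 < p)%N -> (0 < slope_length p b0 b)%N.
Proof.
move=> p_gt1; rewrite /slope_length; case: ifP => _; first by rewrite expn_gt0 (ltnW p_gt1).
by rewrite muln_gt0 expn_gt0 (ltnW p_gt1) andbT -subn1 subn_gt0.
Qed.

(** The inequality is not strict: for [p = 2] the lengths at [b0] and [b0.+1] agree, whence the
    exception in [v_omega_far_bounds]. *)
Lemma slope_length_mono p b0 a b : (1 < p)%N -> (a <= b)%N ->
  (slope_length p b0 a <= slope_length p b0 b)%N.
Proof.
move=> p_gt1 leab; have p1_gt0 : (0 < p.-1)%N by rewrite -subn1 subn_gt0.
rewrite /slope_length; case: (leqP a b0) => [_ | lt_b0a]; last first.
  have -> : (b <= b0)%N = false by lia.
  by rewrite leq_pmul2l // leq_pexp2l ?(ltnW p_gt1) //; lia.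
case: (leqP b b0) => [// | lt_b0b].
by apply: leq_trans (leq_pmull _ p1_gt0); rewrite leq_pexp2l ?(ltnW p_gt1) //; lia.
Qed.

(* The family [X a], [k - s <= a <= k], has one conjugate of [beta] for each
   side of the Newton polygon of [(T + d)^(p^k) - d] at [p], and [delta a] is
   the slope of that side. *)
Lemma places_exist (p k s : nat) (v : algC -> rat) (beta d : algC) :
  prime p -> padic_valuation p v -> v d = 0 -> d != 0 ->
  beta ^+ (p ^ k) = d -> d != d ^+ (p ^ k) -> v (d - d ^+ (p ^ k)) = s%:R + 1 ->
  exists X : nat -> algC, exists delta : nat -> rat,
  [/\ forall a, X a ^+ (p ^ k) = d,
      forall y b, y ^+ (p ^ k) = d -> (k - s <= b <= k)%N ->
        v (y ^+ (p ^ b) - d ^+ (p ^ b)) <= s%:R + 1 - (k - b)%:R &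
  [/\ forall a, (k - s <= a <= k)%N -> v (X a - d) = delta a,
      forall a b, (k - s <= a <= b)%N -> (b <= k)%N ->
        v (X a ^+ (p ^ b) - d ^+ (p ^ b)) = s%:R + 1 - (k - b)%:R,
      forall a b, (k - s <= b < a)%N -> (a <= k)%N ->
        v (X a ^+ (p ^ b) - d ^+ (p ^ b)) = (p ^ b)%:R / (slope_length p (k - s) a)%:R &
  [/\ forall a, (k - s < a <= k)%N -> delta a = (slope_length p (k - s) a)%:R^-1,
      (p ^ (k - s))%:R^-1 <= delta (k - s)%N &
      forall e, (e < p ^ (k - s))%N -> e%:R * delta (k - s)%N = e%:R / (p ^ (k - s))%:R]]].
Proof.
move=> p_pr val_v vd nzd Dbeta neq_d vdN; set b0 := (k - s)%N.
have p_gt1 := prime_gt1 p_pr; have p_gt0 := prime_gt0 p_pr.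
have N_gt0 : (0 < p ^ k)%N by rewrite expn_gt0 p_gt0.
have [z prz] := C_prim_root_exists N_gt0.
have nzb : beta != 0 by apply: contraNneq nzd => b0'; rewrite -Dbeta b0' expr0n gtn_eqF.
have vb : v beta = 0.
  have /eqP := pvalX val_v (p ^ k) nzb; rewrite Dbeta vd eq_sym mulf_eq0 pnatr_eq0 (gtn_eqF
    N_gt0) orbF.
  by move/eqP.
have neq_b : beta ^+ (p ^ k) != d ^+ (p ^ k) by rewrite Dbeta.
have [x xN v_x] := closest_root_exists val_v prz vb nzb neq_b.
rewrite Dbeta in xN; have neq_x : x ^+ (p ^ k) != d ^+ (p ^ k) by rewrite xN.
pose F b := v (x ^+ (p ^ b) - d ^+ (p ^ b)).
have F0 : F 0 = v (x - d) by rewrite /F expn0 !expr1.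
have Frec b : (b < k)%N ->
    F b.+1 = F b + (p.-1 * p ^ b)%:R * Num.min (p.-1 * p ^ b)%:R^-1 (v (x - d)).
  by move=> ltbk; rewrite /F (val_expn_sub_rec p_pr val_v prz neq_x v_x).
have Fk : F k = s%:R + 1 by rewrite /F xN.
have [F_b mu_ge mu_e] := closest_root_recursion p_gt1 F0 Frec Fk.
rewrite -/b0 in F_b mu_ge mu_e.
pose u a : algC := z ^+ (p ^ k %/ p ^ a).
have pru a : (a <= k)%N -> (p ^ a).-primitive_root (u a).
  by move=> leak; apply: dvdn_prim_root => //; apply: dvdn_exp2l.
(* Turning the closest conjugate by a root of unity of exact order [p ^ a] puts it on the side
   [a]. *)
pose X a := if (a <= b0)%N then x else u a * x.
have uX a b : (a <= b <= k)%N -> (X a) ^+ (p ^ b) = x ^+ (p ^ b).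
  move=> /andP[leab lebk]; rewrite /X; case: leqP => // _.
  rewrite exprMn -{1}(subnKC leab) expnD exprM (prim_expr_order (pru _ (leq_trans leab lebk))).
  by rewrite expr1n mul1r.
have b0_phi a : (b0 < a)%N -> slope_length p b0 a = (p.-1 * p ^ a.-1)%N.
  by move=> lt_b0a; rewrite /slope_length leqNgt lt_b0a.
have pb0 : 0 < (p ^ b0)%:R :> rat by rewrite ltr0n expn_gt0 p_gt0.
have mu_ge' : (p ^ b0)%:R^-1 <= v (x - d).
  by rewrite -(ler_pM2l pb0) mulfV // lt0r_neq0.
have min_phi a : (b0 < a)%N ->
    Num.min (p.-1 * p ^ a.-1)%:R^-1 (v (x - d)) = (slope_length p b0 a)%:R^-1.
  move=> lt_b0a; rewrite b0_phi // min_l //; apply: le_trans mu_ge'.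
  rewrite lef_pV2 ?posrE // ?ltr0n -?b0_phi ?slope_length_gt0 //.
  rewrite ler_nat; have := slope_length_mono b0 p_gt1 (ltnW lt_b0a).
  by rewrite {1}/slope_length leqnn.
(* Write y = w x with [w] of order [p ^ a]. If [a <= b], the power [p ^ b] does not see [w];
   otherwise the valuation is at most 1, and 1 is at most [F b]. *)
have v_le y b : y ^+ (p ^ k) = d -> (b0 <= b <= k)%N ->
    v (y ^+ (p ^ b) - d ^+ (p ^ b)) <= s%:R + 1 - (k - b)%:R.
  move=> yN bP; have nzx : x != 0 by apply: contraNneq nzd => x0; rewrite -xN x0 expr0n gtn_eqF.
  have w1 : (y / x) ^+ (p ^ k) = 1 by rewrite expr_div_n yN xN divff.
  have [n prw] := prim_order_exists N_gt0 w1; case/(dvdn_pfactor _ _ p_pr)=> a leak Dn.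
  rewrite {}Dn in prw; rewrite -(divfK nzx y) -F_b //; have /andP[leb0b lebk] := bP.
  have [leab | ltba] := leqP a b.
    by rewrite exprMn -{1}(subnKC leab) expnD exprM (prim_expr_order prw) expr1n mul1r.
  have lt_b0a := leq_ltn_trans leb0b ltba.
  have Da := prednK (leq_ltn_trans (leq0n _) ltba); rewrite -Da in leak prw.
  have ba : (b <= a.-1 < k)%N by rewrite leak andbT; move: ltba; clear; lia.
  rewrite (val_conj_expn_sub p_pr val_v prz neq_x v_x ba prw) min_phi //.
  rewrite ler_pdivrMr ?ltr0n ?slope_length_gt0 // F_b //.
  have le1 : 1 <= s%:R + 1 - (k - b)%:R :> rat.
    by rewrite lerBrDr addrC lerD2r ler_nat; move: leb0b; rewrite /b0; clear; lia.
  apply: le_trans (ler_peMl _ le1); rewrite ?ler0n // ler_nat b0_phi //.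
  apply: leq_trans (leq_pmull _ _); last by rewrite -subn1 subn_gt0.
  by rewrite leq_pexp2l //; move: ltba; clear; lia.
exists X, (fun a => v (X a - d)); split => //.
  move=> a; rewrite /X; case: leqP => // lt_b0a; rewrite exprMn xN.
  by rewrite /u -exprM mulnC exprM (prim_expr_order prz) expr1n mul1r.
split=> //.
- move=> a b /andP[leb0a leab] lebk; rewrite uX ?leab // -/(F b) F_b // lebk andbT.
  exact: leq_trans leab.
- move=> a b /andP[leb0b ltba] leak; have lt_b0a := leq_ltn_trans leb0b ltba.
  rewrite /X [(a <= b0)%N]leqNgt lt_b0a /= -(prednK (leq_ltn_trans (leq0n _) ltba)) in leak *.
  rewrite (val_conj_expn_sub p_pr val_v prz neq_x v_x _ (pru _ leak)).
    by rewrite min_phi // prednK // (leq_ltn_trans _ lt_b0a).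
  by rewrite leak andbT; lia.
split.
- move=> a /andP[lt_b0a leak]; rewrite /X [(a <= b0)%N]leqNgt lt_b0a /=.
  rewrite -(prednK (leq_ltn_trans (leq0n _) lt_b0a)) in leak *.
  rewrite (val_conj_sub p_pr val_v v_x leak (pru _ leak)).
  by rewrite min_phi // prednK // (leq_ltn_trans _ lt_b0a).
- by rewrite /X leqnn.
by move=> e lte; rewrite /X leqnn mu_e.
Qed.

(** * Local independence of the basis *)

(** This is [theta_b], with the quotient of differences expanded as a geometric sum so that it is a
    polynomial in [x]. *)
Definition cofactor_quot (p k b : nat) (d x : algC) : algC :=
  (\sum_(i < p ^ (k - b)) (x ^+ (p ^ b)) ^+ ((p ^ (k - b)).-1 - i) * (d ^+ (p ^ b)) ^+ i)
    / (p ^ (k - b))%:R.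

Lemma cofactor_quotE p k b d x : (0 < p)%N -> (b <= k)%N ->
  x ^+ (p ^ k) - d ^+ (p ^ k) =
  (x ^+ (p ^ b) - d ^+ (p ^ b)) * ((p ^ (k - b))%:R * cofactor_quot p k b d x).
Proof.
move=> p_gt0 lebk; rewrite /cofactor_quot mulrC [X in X * _]mulrC divfK; last first.
  by rewrite pnatr_eq0 -lt0n expn_gt0 p_gt0.
by rewrite mulrC -subrXX -!exprM -expnD subnKC.
Qed.

Section OddRational.

Variable v : algC -> rat.
Hypothesis val_v : padic_valuation 2%N v.

(** The residue field of the rationals at 2 has a single nonzero element. *)
Lemma val_rat_unit_sub1 (q : rat) : q != 0 -> v (ratr q) = 0 -> val_gt v 0 (ratr q - 1).
Proof.
move=> nzq; rewrite (val_rat _ val_v) // => /eqP; rewrite subr_eq0 eqr_nat => /eqP Dlog.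
have nzn : (0 < `|numq q|)%N by rewrite absz_gt0 numq_eq0.
have nzd : (0 < `|denq q|)%N by rewrite absz_gt0 denq_eq0.
have log0 : logn 2 `|denq q| = 0%N.
  apply/eqP; rewrite -leqn0 leqNgt; apply/negP=> lt0.
  have dn : (2 %| `|numq q|)%N by apply: contraLR lt0 => ndvd;
    rewrite -Dlog lognE (negPf ndvd) !andbF.
  have dd : (2 %| `|denq q|)%N by apply: contraLR lt0 => ndvd; rewrite lognE (negPf ndvd) !andbF.
  have := coprime_num_den q; rewrite /coprime => /eqP Dg.
  by have : (2 %| gcdn `|numq q| `|denq q|)%N; [rewrite dvdn_gcd dn dd | rewrite Dg].
have odd_of n : (0 < n)%N -> logn 2 n = 0%N -> odd n.
  by move=> n_gt0; rewrite lognE n_gt0 /= dvdn2; case: (odd n).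
have on := odd_of _ nzn (etrans Dlog log0); have od := odd_of _ nzd log0.
have nzdC : (denq q)%:~R != 0 :> algC by rewrite intr_eq0 denq_eq0.
have -> : ratr q - 1 = (numq q - denq q)%:~R / (denq q)%:~R :> algC.
  by rewrite intrB mulrBl divff // -[q in LHS]divq_num_den rmorphM fmorphV /= !ratr_int.
have [-> | nz] := eqVneq (numq q - denq q) 0; first by rewrite mul0r val_gt0.
rewrite /val_gt (pvalM val_v) ?(pvalV val_v) ?invr_eq0 ?intr_eq0 //.
rewrite !(val_int _ val_v) ?denq_eq0 // log0 subr0 ltr0n orbC lognE absz_gt0 nz /=.
by have -> : (2 %| `|numq q - denq q|)%N by move: on od; clear; rewrite dvdn2; lia.
Qed.

End OddRational.

Section Independence.

Variables (p k s : nat) (v : algC -> rat) (m : int) (X : nat -> algC) (delta : nat -> rat).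
Let d : algC := m%:~R.
Let b0 := (k - s)%N.
Let E := slope_length p b0.

Hypotheses (p_pr : prime p) (val_v : padic_valuation p v).
Hypotheses (vd : v d = 0) (neq_d : d != d ^+ (p ^ k)) (vdN : v (d - d ^+ (p ^ k)) = s%:R + 1).
Hypothesis X_root : forall a, X a ^+ (p ^ k) = d.
Hypothesis v_Xd : forall a, (b0 <= a <= k)%N -> v (X a - d) = delta a.
Hypothesis v_near : forall a b, (b0 <= a <= b)%N -> (b <= k)%N ->
  v (X a ^+ (p ^ b) - d ^+ (p ^ b)) = s%:R + 1 - (k - b)%:R.
Hypothesis v_far : forall a b, (b0 <= b < a)%N -> (a <= k)%N ->
  v (X a ^+ (p ^ b) - d ^+ (p ^ b)) = (p ^ b)%:R / (E a)%:R.
Hypothesis delta_gt : forall a, (b0 < a <= k)%N -> delta a = (E a)%:R^-1.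
Hypothesis delta_ge : (p ^ b0)%:R^-1 <= delta b0.
Hypothesis delta_eq : forall e, (e < p ^ b0)%N -> e%:R * delta b0 = e%:R / (p ^ b0)%:R.

Let p_gt1 : (1 < p)%N := prime_gt1 p_pr.
Let p_gt0 : (0 < p)%N := prime_gt0 p_pr.
Let theta b x := cofactor_quot p k b d x.
Let omega b e x := theta b x * (x - d) ^+ e.

Let Egt0 b : 0 < (E b)%:R :> rat.
Proof. by rewrite ltr0n slope_length_gt0. Qed.

Let Eb0 : E b0 = (p ^ b0)%N.
Proof. by rewrite /E /slope_length leqnn. Qed.

Let sub_neq0 a b : (b <= k)%N -> X a ^+ (p ^ b) - d ^+ (p ^ b) != 0.
Proof.
move=> lebk; apply: contra_neq neq_d => /eqP; rewrite subr_eq0 => /eqP DX.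
by rewrite -{1}(X_root a) -(subnKC lebk) expnD !exprM DX.
Qed.

Let pow_neq0 j : (p ^ j)%:R != 0 :> algC.
Proof. by rewrite pnatr_eq0 -lt0n expn_gt0 p_gt0. Qed.

Let theta_neq0 a b : (b <= k)%N -> theta b (X a) != 0.
Proof.
move=> lebk; have := cofactor_quotE d (X a) p_gt0 lebk.
rewrite -/(theta b (X a)) => Dt; apply: contraNneq (sub_neq0 a (leqnn k)) => t0.
by rewrite Dt t0 !mulr0.
Qed.

Let v_theta a b : (b <= k)%N ->
  v (theta b (X a)) = s%:R + 1 - (k - b)%:R - v (X a ^+ (p ^ b) - d ^+ (p ^ b)).
Proof.
move=> lebk; have := congr1 v (cofactor_quotE d (X a) p_gt0 lebk).
rewrite -/(theta b (X a)) X_root vdN.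
have nzt := theta_neq0 a lebk; have nzp := pow_neq0 (k - b).
rewrite (pvalM val_v) ?(mulf_neq0 nzp nzt) ?sub_neq0 // (pvalM val_v nzp nzt).
have -> : v (p ^ (k - b))%:R = (k - b)%:R.
  by rewrite (val_nat p_pr val_v) ?expn_gt0 ?p_gt0 // pfactorK.
lra.
Qed.

Let Xd_neq0 a : X a - d != 0.
Proof. by have := sub_neq0 a (leq0n k); rewrite expn0 !expr1. Qed.

Let omega_neq0 a b e : (b <= k)%N -> omega b e (X a) != 0.
Proof. by move=> lebk; rewrite mulf_neq0 ?theta_neq0 ?expf_neq0. Qed.

Let v_omega a b e : (b0 <= a <= k)%N -> (b <= k)%N ->
  v (omega b e (X a)) = v (theta b (X a)) + e%:R * delta a.
Proof.
move=> aP lebk; rewrite (pvalM val_v) ?theta_neq0 ?expf_neq0 //.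
by rewrite (pvalX val_v) // v_Xd // [delta a * _]mulrC.
Qed.

Let v_theta_near a b : (b0 <= a <= b)%N -> (b <= k)%N -> v (theta b (X a)) = 0.
Proof. by move=> aP lebk; rewrite v_theta // v_near // subrr. Qed.

Let delta_geE a : (b0 <= a <= k)%N -> (E a)%:R^-1 <= delta a.
Proof.
move=> /andP[leb0a leak]; move: leb0a; rewrite leq_eqVlt => /predU1P[<- | lt_b0a].
  by rewrite Eb0 delta_ge.
by rewrite delta_gt // lt_b0a.
Qed.

Let v_omega_own a e : (b0 <= a <= k)%N -> (e < E a)%N ->
  v (omega a e (X a)) = e%:R / (E a)%:R.
Proof.
move=> /andP[leb0a leak] lteE; rewrite v_omega ?leb0a // v_theta_near ?leb0a ?leqnn // add0r.
move: leb0a; rewrite leq_eqVlt => /predU1P[Da | lt_b0a]; last by rewrite delta_gt // lt_b0a.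
by rewrite -Da Eb0 delta_eq // -Eb0 Da.
Qed.

Let v_omega_far a b e : (b0 <= b < a)%N -> (a <= k)%N -> v (omega b e (X a)) =
  s%:R + 1 - (k - b)%:R - (p ^ b)%:R / (E a)%:R + e%:R / (E a)%:R.
Proof.
move=> /andP[leb0b ltba] leak; have lebk := ltnW (leq_trans ltba leak).
have lt_b0a := leq_ltn_trans leb0b ltba.
by rewrite v_omega ?v_theta ?v_far ?delta_gt ?leb0b ?lt_b0a ?(ltnW lt_b0a).
Qed.

Let frac_lt1 b e : (e < E b)%N -> e%:R / (E b)%:R < 1 :> rat.
Proof. by move=> lteE; rewrite ltr_pdivrMr ?Egt0 // mul1r ltr_nat. Qed.

Let frac_ge0 b e : 0 <= e%:R / (E b)%:R :> rat.
Proof. by rewrite divr_ge0 // ler0n. Qed.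

Let v_omega_near_ge a b e : (b0 <= a <= b)%N -> (b <= k)%N ->
  e%:R / (E b)%:R <= v (omega b e (X a)).
Proof.
move=> /andP[leb0a leab] lebk; have leak := leq_trans leab lebk.
rewrite v_omega ?leb0a // v_theta_near ?leb0a // add0r ler_wpM2l ?ler0n //.
apply: le_trans (delta_geE _); last by rewrite leb0a.
by rewrite lef_pV2 ?posrE ?Egt0 // ler_nat slope_length_mono.
Qed.

(** Put S = s + 1 - (k - b) and rho = p^b / E a, so that rho <= 1; the value is S - rho + e / E a.
    If [b0 < b], then S >= 2 and the value is at least 1. If [b = b0], it is S - rho (1 - eps) with
    eps = e / p^b0, which exceeds eps unless S = rho = 1; this forces [s <= k], [p = 2] and
    [a = b0.+1]. *)
Let v_omega_far_bounds a b e : (b0 <= b < a)%N -> (a <= k)%N -> (e < E b)%N ->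
  e%:R / (E b)%:R <= v (omega b e (X a)) /\
  (~~ [&& p == 2%N, (s <= k)%N, a == b0.+1 & b == b0] -> e%:R / (E b)%:R < v (omega b e (X a))).
Proof.
move=> bP leak lteE; rewrite v_omega_far //; have /andP[leb0b ltba] := bP.
have f1 := frac_lt1 lteE; have f0 := frac_ge0 b e; have f0' := frac_ge0 a e.
have DEa : E a = (p.-1 * p ^ a.-1)%N.
  by rewrite /E /slope_length; case: leqP => // leab0;
    have := leq_trans ltba (leq_trans leab0 leb0b); rewrite ltnn.
have p1_gt0 : (0 < p.-1)%N by rewrite -subn1 subn_gt0.
have le_pb : (p ^ b <= p ^ a.-1)%N by rewrite leq_pexp2l //; lia.
have le_pE : (p ^ b <= E a)%N by rewrite DEa; apply: leq_trans le_pb (leq_pmull _ p1_gt0).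
have rho_le1 : (p ^ b)%:R / (E a)%:R <= 1 :> rat.
  by rewrite ler_pdivrMr ?Egt0 // mul1r ler_nat.
have [lt_b0b | ] := ltnP b0 b.
  have S2 : (k - b)%:R + 2 <= s%:R + 1 :> rat by rewrite natr1 -natrD ler_nat /b0 in lt_b0b *;
    lia.
  by split=> [|_]; lra.
move=> leb_b0; have Db : b = b0 by apply/eqP; rewrite eqn_leq leb_b0.
rewrite Db Eb0 in f1 f0 rho_le1 *.
have -> : e%:R / (E a)%:R = (e%:R / (p ^ b0)%:R) * ((p ^ b0)%:R / (E a)%:R) :> rat.
  by rewrite mulrA divfK // pnatr_eq0 -lt0n expn_gt0 p_gt0.
set eps := e%:R / _ in f1 f0 *; set rho := _ / _ in rho_le1 *.
have S1 : (k - b0)%:R + 1 <= s%:R + 1 :> rat by rewrite lerD2r ler_nat /b0; lia.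
split=> [|nexc]; first by nra.
have [ltks | lesk] := ltnP k s.
  have : (k - b0)%:R + 2 <= s%:R + 1 :> rat by rewrite natr1 -natrD ler_nat /b0; lia.
  by nra.
suff : rho < 1 by nra.
rewrite /rho ltr_pdivrMr ?Egt0 // mul1r ltr_nat DEa.
move: nexc; rewrite lesk eqxx andbT /= negb_and => /orP[p2 | ab0].
  apply: leq_ltn_trans (_ : p ^ a.-1 < _)%N; first by rewrite -Db.
  by rewrite ltn_Pmull ?expn_gt0 ?p_gt0 //; move: p_gt1 p2; clear; lia.
apply: leq_trans (leq_pmull _ p1_gt0); rewrite ltn_exp2l //.
by move: ltba ab0; rewrite Db; clear; lia.
Qed.

Let v_omega_ge a b e : (b0 <= a <= k)%N -> (b0 <= b <= k)%N -> (e < E b)%N ->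
  e%:R / (E b)%:R <= v (omega b e (X a)).
Proof.
move=> /andP[leb0a leak] /andP[leb0b lebk] lteE.
have [leab | ltba] := leqP a b; first by rewrite v_omega_near_ge // leb0a.
by have [] := @v_omega_far_bounds a b e; rewrite ?leb0b.
Qed.

(* For [p = 2] and [1 <= s <= k] the first two slopes coincide: the residual
   polynomial of the corresponding side is the irreducible [y^2 + y + 1] over
   [F_2], so that no cancellation occurs here either. *)
Let v_theta_pair (c c' : rat) : p = 2%N -> (s <= k)%N -> (b0 < k)%N -> c != 0 -> c' != 0 ->
  v (ratr c) = v (ratr c') ->
  let y := ratr c * theta b0.+1 (X b0) + ratr c' * theta b0 (X b0) in
  y != 0 /\ v y = v (ratr c).
Proof.
move=> p2 lesk ltb0k nzc nzc' Dvc y; set x := X b0 in y *.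
have ratr_neq0 (q : rat) : q != 0 -> ratr q != 0 :> algC by rewrite fmorph_eq0.
have Db0 : (k - b0 = s)%N by rewrite /b0; lia.
pose M : algC := d ^+ (p ^ b0); pose A := x ^+ (p ^ b0).
have vt0 : v (theta b0 x) = 0 by rewrite v_theta_near ?leqnn // ltnW.
have vt1 : v (theta b0.+1 x) = 0 by rewrite v_theta_near ?leqnn ?leqnSn.
have nzt1 : theta b0.+1 x != 0 by apply: theta_neq0.
have nzt0 : theta b0 x != 0 by apply: theta_neq0; apply: ltnW.
have nz2 : 2%:R != 0 :> algC by rewrite pnatr_eq0.
have v2 : v 2%:R = 1 by move: (pvalp val_v); rewrite p2.
have nzAM : A - M != 0 by apply: sub_neq0; apply: ltnW.
pose tau := (A + M) / 2%:R.
(* For [p = 2] the quotient of two consecutive theta is (A^2 - M^2) / (A - M), halved. *)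
have Dtheta : theta b0 x = theta b0.+1 x * tau.
  have := cofactor_quotE d x p_gt0 (ltnW ltb0k).
  rewrite (cofactor_quotE d x p_gt0 ltb0k) -/(theta b0 x) -/(theta b0.+1 x) -/A -/M.
  have -> : x ^+ (p ^ b0.+1) - d ^+ (p ^ b0.+1) = (A - M) * (A + M).
    by rewrite expnSr !exprM -/A -/M p2 subr_sqr.
  rewrite -mulrA => /(mulfI nzAM).
  have -> : (p ^ (k - b0))%:R = 2%:R * (p ^ (k - b0.+1))%:R :> algC.
    have Dsub : (k - b0 = (k - b0.+1).+1)%N by move: ltb0k; clear; lia.
    by rewrite Dsub expnS natrM {1}p2.
  move=> Dt; apply: (mulfI (pow_neq0 (k - b0.+1))); apply: (mulfI nz2).
  by rewrite mulrA -Dt /tau; field.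
have nztau : tau != 0 by apply: contraNneq nzt0 => t0; rewrite Dtheta t0 mulr0.
have vtau : v tau = 0.
  by have := vt0; rewrite Dtheta (pvalM val_v nzt1 nztau) vt1 add0r.
have DtM : tau - M = (A - M) / 2%:R by rewrite /tau; field.
have nztM : tau - M != 0 by rewrite DtM mulf_neq0 ?invr_eq0.
have vtM : v (tau - M) = 0.
  rewrite DtM (pvalM val_v) ?invr_eq0 // (pvalV val_v) // v2 v_near ?leqnn ?Db0 1?ltnW //.
  by lra.
pose q := c' / c; have nzq : q != 0 by rewrite mulf_neq0 ?invr_eq0.
have Dq : ratr q = ratr c' / ratr c :> algC by rewrite rmorphM fmorphV.
have vq : v (ratr q) = 0.
  rewrite Dq (pvalM val_v) ?invr_eq0 ?ratr_neq0 // (pvalV val_v) ?ratr_neq0 // Dvc.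
  by rewrite subrr.
have val2 : padic_valuation 2%N v by rewrite -p2.
have gtq : val_gt v 0 (ratr q - 1) by apply: val_rat_unit_sub1.
have nzd : d != 0.
  by apply: contraNneq neq_d => d0; rewrite d0 expr0n gtn_eqF // expn_gt0 p_gt0.
have nzM : M != 0 by rewrite expf_neq0.
have DM : ratr (- (m ^+ (p ^ b0))%:~R) = - M :> algC.
  by rewrite rmorphN /= ratr_int /M /d rmorphXn.
have nzMq : - (m ^+ (p ^ b0))%:~R != 0 :> rat.
  by rewrite oppr_eq0 intr_eq0 expf_neq0 // -(intr_eq0 algC).
have gtM : val_gt v 0 (- M - 1).
  rewrite -DM; apply: val_rat_unit_sub1 => //.
  by rewrite DM (pvalN val_v) // (pvalX val_v) // vd mul0r.
have gtauq : val_gt v 0 ((ratr q - 1) * tau).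
  rewrite /val_gt; have [q1 | nz] := eqVneq (ratr q - 1 : algC) 0; first by rewrite q1 mul0r eqxx.
  by move: gtq; rewrite /val_gt (negPf nz) mulf_eq0 (negPf nz) (negPf nztau) (pvalM val_v) //
    vtau addr0.
(* The last factor is 1 + q tau. As [q] and [- M] are both 1 modulo terms of positive valuation, it
   reduces to [tau - M] = (A - M) / 2, a unit because v(A - M) = 1. *)
have Dy : y = ratr c * theta b0.+1 x * ((tau - M) + (- (- M - 1) + (ratr q - 1) * tau)).
  by rewrite /y Dtheta Dq; field; apply: ratr_neq0.
have [|nz1 v1] := @val_add_gt _ _ val_v (tau - M) (- (- M - 1) + (ratr q - 1) * tau) nztM.
  rewrite vtM; apply: (val_gtD val_v) => //; rewrite -[- (- M - 1)]mulN1r;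
    apply: (val_gtM val_v) => //.
  by rewrite rpredN Aint1.
have nzcq := ratr_neq0 c nzc; have nzct : ratr c * theta b0.+1 x != 0 by exact: mulf_neq0.
rewrite Dy; split; first exact: mulf_neq0.
by rewrite (pvalM val_v nzct nz1) (pvalM val_v nzcq nzt1) vt1 v1 vtM !addr0.
Qed.

(** [key i] is the valuation that the term [i] has at a conjugate of its own side, and a lower bound
    for it at the others. A coefficient with negative valuation has valuation at most -1, so its key
    is negative; the term of least key then spoils the sum at a suitable conjugate. *)
Lemma independent_coefs (I : finType) (bI eI : I -> nat) (c : I -> rat) :
  (forall i, (b0 <= bI i <= k)%N) -> (forall i, (eI i < E (bI i))%N) ->
  (forall i j, bI i = bI j -> eI i = eI j -> i = j) ->
  (forall a, (b0 <= a <= k)%N -> let y := \sum_i ratr (c i) *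
     (cofactor_quot p k (bI i) d (X a) * (X a - d) ^+ eI i) in y != 0 -> 0 <= v y) ->
  forall i, c i != 0 -> 0 <= v (ratr (c i)).
Proof.
move=> bP eP inj Yint i0 nzc0; rewrite leNgt; apply/negP=> neg.
pose vc i := v (ratr (c i)); pose key i := vc i + (eI i)%:R / (E (bI i))%:R.
have fr1 i := frac_lt1 (eP i); have fr0 i := frac_ge0 (bI i) (eI i).
have vcE i : c i != 0 -> exists n n' : nat, vc i = n%:R - n'%:R.
  by move=> nzc; rewrite /vc (val_rat p_pr val_v nzc); do 2!eexists.
have key_lt0 : key i0 < 0.
  have [n [n' Dv]] := vcE _ nzc0; have := fr1 i0; rewrite /key Dv.
  move: neg; rewrite -/(vc i0) Dv subr_lt0 ltr_nat -(ler_nat rat) -natr1; lra.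
have [i1 nzc1 min1] := @arg_minP _ _ _ i0 (fun i => c i != 0) key nzc0.
pose Q i := (c i != 0) && (key i == key i1).
have Qi1 : Q i1 by rewrite /Q nzc1 eqxx.
(* Among the least keys the largest side index is taken: on that side, terms with smaller [bI] are
   strictly larger in valuation (up to the exception), whereas terms with larger [bI] could tie, for
   instance when [eI] is 0. *)
have [r /andP[nzr /eqP keyr] maxr] := @arg_maxnP _ i1 Q bI Qi1.
have {}min1 i : c i != 0 -> key r <= key i by rewrite keyr; apply: min1.
have keyr_lt0 : key r < 0 by apply: le_lt_trans (min1 i0 nzc0) key_lt0.
(* A key is an integer plus a fraction in [0, 1), so equal keys over one denominator have equal
   parts. *)
have tie i : c i != 0 -> key i = key r -> E (bI i) = E (bI r) ->
    vc i = vc r /\ eI i = eI r.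
  move=> nzi Dk DE; have [n [n' Dn]] := vcE _ nzi; have [l [l' Dl]] := vcE _ nzr.
  have Dv : vc i = vc r.
    have lt1 : (n + l')%:R < (l + n')%:R + 1 :> rat.
      by move: Dk (fr1 r) (fr0 i); rewrite /key Dn Dl !natrD; lra.
    have lt2 : (l + n')%:R < (n + l')%:R + 1 :> rat.
      by move: Dk (fr1 i) (fr0 r); rewrite /key Dn Dl !natrD; lra.
    move: lt1 lt2; rewrite !natr1 !ltr_nat => lt1 lt2.
    have : (n + l' = l + n')%N by move: lt1 lt2; clear; lia.
    by move/(congr1 (fun j => j%:R : rat)); rewrite Dn Dl !natrD; lra.
  split=> //; move: Dk; rewrite /key Dv DE => /addrI/(mulIf _).
  rewrite invr_eq0 lt0r_neq0 ?Egt0 // => /(_ isT)/eqP.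
  by rewrite eqr_nat => /eqP.
pose t a i := ratr (c i) * omega (bI i) (eI i) (X a).
have Dt a : \sum_i ratr (c i) * (cofactor_quot p k (bI i) d (X a) * (X a - d) ^+ eI i)
    = \sum_i t a i by [].
have nz_om a i : omega (bI i) (eI i) (X a) != 0 by apply: omega_neq0; case/andP: (bP i).
have v_t a i : c i != 0 -> v (t a i) = vc i + v (omega (bI i) (eI i) (X a)).
  by move=> nzi; rewrite (pvalM val_v) // fmorph_eq0.
have v_t_ge a i : (b0 <= a <= k)%N -> c i != 0 -> key i <= v (t a i).
  by move=> aP nzi; rewrite v_t // lerD2l v_omega_ge.
have t_gt a i : (b0 <= a <= k)%N -> (c i != 0 -> key i = key r -> key i < v (t a i)) ->
    val_gt v (key r) (t a i).
  move=> aP lt_t; have [ci0 | nzi] := eqVneq (c i) 0.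
    by rewrite /t ci0 rmorph0 mul0r val_gt0.
  rewrite /val_gt; apply/orP; right.
  have := min1 i nzi; rewrite le_eqVlt => /predU1P[Dk | lt_k].
    by rewrite Dk lt_t.
  exact: lt_le_trans (v_t_ge a i aP nzi).
have no_val a y : (b0 <= a <= k)%N -> \sum_i t a i = y -> y != 0 -> v y = key r -> False.
  move=> aP Dy nzy vy; have := Yint a aP; rewrite /= Dt Dy => /(_ nzy).
  by rewrite vy leNgt keyr_lt0.
have far_max a i : (b0 <= a <= k)%N -> c i != 0 -> key i = key r -> (bI i <= bI r)%N.
  by move=> aP nzi Dk; apply: maxr; rewrite /Q nzi Dk keyr eqxx.
have nz_t a i : c i != 0 -> t a i != 0.
  by move=> nzi; rewrite mulf_neq0 // fmorph_eq0.
(* In the exceptional case [r] and [r'] tie on their sides; both are evaluated on the side [b0],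
   where they have the same power of X - d and [v_theta_pair] excludes cancellation. *)
have [/existsP[r' /and5P[nzr' /eqP Dk' /eqP p2 lesk]] | noexc] := boolP [exists r',
    [&& c r' != 0, key r' == key r, p == 2%N, (s <= k)%N & (bI r == b0.+1) && (bI r' == b0)]].
  move=> /andP[/eqP Dbr /eqP Dbr'].
  have ltb0k : (b0 < k)%N by rewrite -Dbr; case/andP: (bP r).
  have DE : E b0.+1 = E b0.
    by rewrite /E /slope_length leqnn ltnn p2 mul1n.
  have [Dv' De'] : vc r' = vc r /\ eI r' = eI r by apply: tie => //; rewrite Dbr Dbr' DE.
  have aP : (b0 <= b0 <= k)%N by rewrite leqnn ltnW.
  have neq_r : r' != r by apply: contra_eq_neq Dbr => <-; rewrite Dbr' neq_ltn ltnSn.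
  have [nzy vy] := v_theta_pair p2 lesk ltb0k nzr nzr' (esym Dv').
  pose y := t b0 r + t b0 r'.
  have Dy : y = (ratr (c r) * theta b0.+1 (X b0) + ratr (c r') * theta b0 (X b0))
      * (X b0 - d) ^+ eI r.
    by rewrite /y /t /omega Dbr Dbr' De' mulrDl !mulrA.
  have nzX : (X b0 - d) ^+ eI r != 0 by rewrite expf_neq0.
  have nzy' : y != 0 by rewrite Dy mulf_neq0.
  have vy' : v y = key r.
    rewrite Dy (pvalM val_v nzy nzX) vy (pvalX val_v) // v_Xd // mulrC delta_eq.
      by rewrite /key Dbr DE Eb0.
    by rewrite -Eb0 -DE -Dbr.
  have [|nzS vS] := @val_add_gt _ _ val_v y (\sum_(i | (i != r) && (i != r')) t b0 i) nzy'.
    rewrite vy'; apply: (val_gt_sum val_v) => i /andP[ir ir']; apply: t_gt => // nzi Dk.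
    rewrite v_t // ltrD2l.
    have leb := far_max b0 i aP nzi Dk; rewrite Dbr in leb.
    have Ei : E (bI i) = E b0.
      have /andP[leb0 _] := bP i.
      by have [<- // | ->] : bI i = b0 \/ bI i = b0.+1 by move: leb leb0; clear; lia.
    have [Dvi Dei] := tie i nzi Dk (etrans Ei (esym (etrans (congr1 E Dbr) DE))).
    have /andP[leb0 _] := bP i.
    have [Dbi | Dbi] : bI i = b0 \/ bI i = b0.+1 by move: leb leb0; clear; lia.
      by case/eqP: ir'; apply: inj; rewrite ?Dbi ?Dbr' ?Dei ?De'.
    by case/eqP: ir; apply: inj; rewrite ?Dbi ?Dbr ?Dei.
  apply: (no_val b0 _ aP _ nzS); last by rewrite vS vy'.
  by rewrite (bigD1 r) //= (bigD1 r') //= addrA.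
have aP := bP r.
have v_r : v (t (bI r) r) = key r by rewrite v_t // v_omega_own.
have [|nzS vS] := @val_add_gt _ _ val_v (t (bI r) r) (\sum_(i
  | i != r) t (bI r) i) (nz_t _ _ nzr).
  rewrite v_r; apply: (val_gt_sum val_v) => i ir; apply: t_gt => // nzi Dk.
  rewrite v_t // ltrD2l.
  have := far_max (bI r) i aP nzi Dk; rewrite leq_eqVlt => /predU1P[Db | ltb].
    have [_ De] := tie i nzi Dk (congr1 E Db).
    by case/eqP: ir; apply: inj.
  have /andP[leb0 _] := bP i; have /andP[_ lek] := aP.
  have [|_] := @v_omega_far_bounds (bI r) (bI i) (eI i) _ lek (eP i); first by rewrite leb0.
  apply; apply: contra noexc => /and4P[p2 lesk Dbr Dbi].
  by apply/existsP; exists i; rewrite nzi Dk eqxx p2 lesk Dbr Dbi.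
apply: (no_val (bI r) _ aP _ nzS); last by rewrite vS.
by rewrite (bigD1 r).
Qed.

End Independence.

(** * The index as a product of leading denominators *)

Section PureField.

Variables (m : int) (N : nat) (alpha : algC).
Hypotheses (N_gt0 : (0 < N)%N) (alphaN : alpha ^+ N = m%:~R).
Hypothesis X_irr : irreducible_poly ('X^N - m%:~R%:P : {poly rat}).

Let f : {poly rat} := 'X^N - m%:~R%:P.

Let monic_f : f \is monic. Proof. exact: monicXnsubC. Qed.

Lemma horner_ratr_pure (beta : algC) : beta ^+ N = m%:~R -> (map_poly ratr f).[beta] = 0.
Proof.
move=> bN; rewrite /f rmorphB /= map_polyXn map_polyC /= ratr_int.
by rewrite hornerD hornerN hornerXn hornerC bN subrr.
Qed.

Lemma dvdp_pure (Y : {poly rat}) : ((map_poly ratr Y).[alpha] == 0) = (f %| Y).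
Proof.
have [q [Dq mon_q] q_dv] := minCpolyP alpha.
have q_f : q %| f by rewrite -q_dv; apply/rootP/horner_ratr_pure.
have sq : size q != 1%N.
  by have := size_minCpoly alpha; rewrite Dq size_map_poly; case: eqP => // ->.
have /eqp_dvdl <- := apply_irredp X_irr sq q_f.
by rewrite -q_dv.
Qed.

Lemma horner_pure_inj (Y Z : {poly rat}) : (size Y <= N)%N -> (size Z <= N)%N ->
  (map_poly ratr Y).[alpha] = (map_poly ratr Z).[alpha] -> Y = Z.
Proof.
move=> sY sZ DYZ; apply/eqP; rewrite -subr_eq0; apply: contraT => nz.
have: f %| Y - Z by rewrite -dvdp_pure rmorphB hornerD hornerN DYZ subrr.
move/(dvdp_leq nz); rewrite size_XnsubC // => sN.
by have := leq_trans sN (size_polyD _ _); rewrite size_polyN ltnNge geq_max sY sZ.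
Qed.

(** Composed with [Y], the minimal polynomial of Y(alpha) is divisible by [f]; so Y(beta) is one of
    its roots. *)
Lemma Aint_conj_pure (Y : {poly rat}) (beta : algC) : beta ^+ N = m%:~R ->
  (map_poly ratr Y).[alpha] \in Aint -> (map_poly ratr Y).[beta] \in Aint.
Proof.
move=> bN; set y := (map_poly ratr Y).[alpha] => Ay.
have [q [Dq mon_q] q_dv] := minCpolyP y.
apply: (@root_monic_Aint (minCpoly y)); [|exact: minCpoly_monic | exact: Ay].
have : root (map_poly ratr (q \Po Y)) alpha.
  by rewrite map_comp_poly /root horner_comp -Dq; apply: root_minCpoly.
rewrite /root dvdp_pure => /dvdpP[Q DQ].
rewrite Dq /root -horner_comp -map_comp_poly DQ rmorphM hornerM.
by rewrite horner_ratr_pure ?mulr0.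
Qed.

(* The coefficient of ['X^i] is recovered from the trace of
   [Y(alpha) * alpha ^+ (N - i)]. *)
Lemma coef_pure_int (Y : {poly rat}) i : (size Y <= N)%N -> (i < N)%N ->
  (map_poly ratr Y).[alpha] \in Aint -> (N%:R * m%:~R) * Y`_i \is a Num.int.
Proof.
move=> sY lt_iN AY; have [z prz] := C_prim_root_exists N_gt0.
have sum_z j : \sum_(t < N) z ^+ (t * j) = (if (N %| j)%N then N%:R else 0).
  have -> : \sum_(t < N) z ^+ (t * j) = \sum_(t < N) (z ^+ j) ^+ t.
    by apply: eq_bigr => t _; rewrite -exprM mulnC.
  case: ifP => [/dvdnP[c ->] | ndvd].
    rewrite mulnC exprM (prim_expr_order prz); under eq_bigr do rewrite !expr1n.
    by rewrite sumr_const card_ord.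
  have nz : z ^+ j - 1 != 0 by rewrite subr_eq0 -(prim_order_dvd prz) ndvd.
  by apply: (mulfI nz); rewrite -subrX1 -exprM mulnC exprM (prim_expr_order prz) expr1n subrr
    mulr0.
have azN t : (alpha * z ^+ t) ^+ N = m%:~R.
  by rewrite exprMn -exprM mulnC exprM (prim_expr_order prz) expr1n mulr1.
have Aaz t : alpha * z ^+ t \in Aint.
  apply: (@root_monic_Aint ('X^N - m%:~R%:P)); rewrite ?monicXnsubC //.
    by rewrite /root hornerD hornerN hornerXn hornerC azN subrr.
  apply/polyOverP=> i'; rewrite coefB coefC coefXn rpredB ?rpred_nat //.
  by case: ifP; rewrite ?rpred_int ?rpred0.
have tr : \sum_(t < N) (map_poly ratr Y).[alpha * z ^+ t] * (alpha * z ^+ t) ^+ (N - i) =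
    ratr ((N%:R * m%:~R) * Y`_i).
  under eq_bigr => t _ do rewrite (@horner_coef_wide _ N) ?size_map_poly // mulr_suml.
  rewrite exchange_big /= (bigD1 (Ordinal lt_iN)) //= [X in _ + X]big1 => [|l neq_li].
    rewrite addr0 (eq_bigr (fun=> ratr Y`_i * m%:~R)) => [|t _].
      by rewrite sumr_const card_ord !rmorphM /= ratr_nat ratr_int -mulr_natl; ring.
    by rewrite coef_map -mulrA -exprD subnKC ?(ltnW lt_iN) // azN.
  rewrite (eq_bigr (fun t : 'I_N => (ratr Y`_l * alpha ^+ (l + (N - i))) * z ^+ (t * (l + (N -
    i))))).
    (* The exponent [l + (N - i)] lies strictly between 0 and [2 N], so only [l = i] survives. *)
    rewrite -mulr_sumr sum_z; case: ifP => [dvd|]; last by rewrite mulr0.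
    case/eqP: neq_li; apply/val_inj => /=; move: dvd (ltn_ord l) lt_iN; clear => /dvdnP[c Dc].
    case: c Dc => [|[|c]]; lia.
  by move=> t _; rewrite coef_map -mulrA -exprD exprMn -exprM mulrA.
rewrite -Cint_rat -tr; apply: Cint_rat_Aint; first by rewrite tr Crat_rat.
rewrite rpred_sum // => t _; rewrite rpredM ?rpredX //.
exact: Aint_conj_pure AY.
Qed.

End PureField.

(** Eisenstein at any prime divisor of [m]; one exists because square-freeness also excludes 0. *)
Lemma pure_irreducible (m : int) (N : nat) : (0 < N)%N -> m != 1 -> m != -1 ->
  (forall q : nat, prime q -> ~~ (q ^ 2 %| `|m|)%N) ->
  irreducible_poly ('X^N - m%:~R%:P : {poly rat}).
Proof.
move=> N_gt0 m1 mN1 sqf.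
have -> : 'X^N - m%:~R%:P = map_poly (intr : int -> rat) ('X^N - m%:P).
  by rewrite rmorphB /= map_polyXn map_polyC.
apply/irreducible_rat_int.
have m_gt1 : (1 < `|m|)%N.
  have m0 : m != 0 by apply: contraNneq (sqf 2%N isT) => ->.
  by move: m0 m1 mN1; clear; lia.
have q_pr := pdiv_prime m_gt1; set q := pdiv _ in q_pr.
have q_m : (q %| `|m|)%N := pdiv_dvd _.
have sf : size ('X^N - m%:P : {poly int}) = N.+1 by rewrite size_XnsubC.
apply: (eisenstein_crit q_pr).
- by rewrite sf; case: (N) N_gt0.
- rewrite (monicP (monicXnsubC _ N_gt0)) -topredE /= /dvdz dvdn1.
  by rewrite gtn_eqF // prime_gt1.
- rewrite coefB coefXn coefC /= ltn_eqF // sub0r -topredE /= /dvdz abszN.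
  exact: sqf.
rewrite sf => i lt_iN; rewrite coefB coefXn coefC ltn_eqF //= sub0r dvdzE abszN.
by case: eqP.
Qed.

(** * Triangular bases and representatives modulo Z[alpha] *)

Section LatticeIndex.

Variables (m : int) (N : nat) (alpha : algC).
Hypotheses (N_gt0 : (0 < N)%N) (nz_m : m != 0) (alphaN : alpha ^+ N = m%:~R).
Hypothesis X_irr : irreducible_poly ('X^N - m%:~R%:P : {poly rat}).

Let ev (Y : {poly rat}) : algC := (map_poly ratr Y).[alpha].

Let evB Y Z : ev (Y - Z) = ev Y - ev Z.
Proof. by rewrite /ev rmorphB hornerD hornerN. Qed.

Let evZ c Y : ev (c *: Y) = ratr c * ev Y.
Proof. by rewrite /ev map_polyZ hornerZ. Qed.

Let evD Y Z : ev (Y + Z) = ev Y + ev Z.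
Proof. by rewrite /ev rmorphD hornerD. Qed.

Let Aint_alpha : alpha \in Aint.
Proof.
apply: (@root_monic_Aint ('X^N - m%:~R%:P)); rewrite ?monicXnsubC //.
  by rewrite /root hornerD hornerN hornerXn hornerC alphaN subrr.
apply/polyOverP=> i; rewrite coefB coefC coefXn rpredB ?rpred_nat //.
by case: ifP; rewrite ?rpred_int ?rpred0.
Qed.

Let AevXn i : ev 'X^i \in Aint.
Proof. by rewrite /ev map_polyXn hornerXn rpredX. Qed.

Let Aev_comb (u w : int) Y Z : ev Y \in Aint -> ev Z \in Aint ->
  ev (u%:~R *: Y + w%:~R *: Z) \in Aint.
Proof.
by move=> AY AZ; rewrite evD !evZ !ratr_int rpredD // rpredM // Aint_int.
Qed.

(** The coefficients at degree [i] of integral elements of degree at most [i] form a group (1/d)Z;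
    [d] is the largest denominator attained, which exists by the trace bound [coef_pure_int]. *)
Lemma leading_denominator i : (i < N)%N -> exists (d : nat) (h : {poly rat}),
  [/\ (0 < d)%N, ev h \in Aint, (size h <= i.+1)%N, h`_i = d%:R^-1 &
      forall Y, ev Y \in Aint -> (size Y <= i.+1)%N -> d%:R * Y`_i \is a Num.int].
Proof.
move=> lt_iN.
pose P d := (0 < d)%N /\ exists h : {poly rat}, [/\ ev h \in Aint, (size h <= i.+1)%N & h`_i =
  d%:R^-1].
have P1 : exists d, `[< P d >].
  exists 1%N; apply/asboolP; split=> //; exists 'X^i.
  by rewrite AevXn size_polyXn coefXn eqxx invr1.
have P_le d : `[< P d >] -> (d <= N * `|m|)%N.
  move=> /asboolP[d_gt0 [h [Ah sh Dh]]].
  have sh' : (size h <= N)%N by apply: leq_trans sh lt_iN.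
  have := coef_pure_int N_gt0 alphaN X_irr sh' lt_iN Ah; rewrite Dh => /intrP[c Dc].
  have nzd : d%:R != 0 :> rat by rewrite pnatr_eq0 -lt0n.
  have {}Dc : (N%:Z * m = c * d%:Z)%R.
    apply: (@intr_inj rat); rewrite !intrM -Dc divfK //.
  have : (d %| N * `|m|)%N by rewrite -[(N * _)%N]/(`|N%:Z| * `|m|)%N -abszM Dc abszM dvdn_mull.
  by apply: dvdn_leq; rewrite muln_gt0 N_gt0 absz_gt0.
have [d /asboolP[d_gt0 [h [Ah sh Dh]]] maxd] := ex_maxnP P1 P_le.
exists d, h; split=> // Y AY sY; set c := Y`_i.
pose b := `|denq c|%N; have b_gt0 : (0 < b)%N by rewrite absz_gt0 denq_eq0.
have Db : denq c = b%:Z by rewrite /b gez0_abs // denq_ge0.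
have nzb : b%:R != 0 :> rat by rewrite pnatr_eq0 -lt0n.
have nzd : d%:R != 0 :> rat by rewrite pnatr_eq0 -lt0n.
have Dc : c = (numq c)%:~R / b%:R by rewrite -[c in LHS]divq_num_den Db.
have Dcb : c * b%:R = (numq c)%:~R by rewrite [c in LHS]Dc divfK.
have [[u w] /= Duw] : exists uw : int * int, uw.1 * numq c + uw.2 * b%:Z = 1.
  by apply/coprimezP; rewrite -Db coprimezE coprime_num_den.
have [u1 [w1 Dg]] := Bezoutz b%:Z d%:Z.
have Dgq : u1%:~R * b%:R + w1%:~R * d%:R = (gcdn b d)%:R :> rat.
  by rewrite -[RHS]/((gcdz b%:Z d%:Z)%:~R) -Dg intrD !intrM.
have Duwq : u%:~R * (numq c)%:~R + w%:~R * b%:R = 1 :> rat.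
  by rewrite -[RHS]/(1%:~R) -Duw intrD !intrM.
have Dlcm : (lcmn b d)%:R * (gcdn b d)%:R = b%:R * d%:R :> rat by rewrite -!natrM muln_lcm_gcd.
have l_gt0 : (0 < lcmn b d)%N by rewrite lcmn_gt0 b_gt0.
have nzl : (lcmn b d)%:R != 0 :> rat by rewrite pnatr_eq0 -lt0n.
(* Bezout for the numerator and denominator of [c] replaces [c] by [1 / b]. *)
pose Z := u%:~R *: Y + w%:~R *: 'X^i.
have AZ : ev Z \in Aint by apply: Aev_comb.
have sXi : (size ('X^i : {poly rat}) <= i.+1)%N by rewrite size_polyXn.
have s_comb (a e : rat) (Q1 Q2 : {poly rat}) : (size Q1 <= i.+1)%N -> (size Q2 <= i.+1)%N ->
    (size (a *: Q1 + e *: Q2)%R <= i.+1)%N.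
  move=> s1 s2; apply: leq_trans (size_polyD _ _) _; rewrite geq_max.
  by rewrite !(leq_trans (size_scale_leq _ _)).
have DZ : Z`_i = b%:R^-1.
  rewrite coefD !coefZ coefXn eqxx mulr1 -/c; apply: (mulIf nzb).
  by rewrite mulVf // mulrDl -mulrA Dcb.
(* Bezout for [b] and [d] makes the inverse of their lcm a leading coefficient too; maximality of
   [d] then forces [b] to divide [d]. *)
have Pl : `[< P (lcmn b d) >].
  apply/asboolP; split=> //; exists (w1%:~R *: Z + u1%:~R *: h); split.
  - exact: Aev_comb.
  - by rewrite !s_comb.
  rewrite coefD !coefZ DZ Dh; apply: (mulIf nzl); rewrite mulVf //.
  apply: (mulIf (mulf_neq0 nzb nzd)); rewrite -[in LHS]Dlcm mul1r.
  have nzg : (gcdn b d)%:R != 0 :> rat by rewrite pnatr_eq0 -lt0n gcdn_gt0 b_gt0.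
  have -> : (lcmn b d)%:R = b%:R * d%:R / (gcdn b d)%:R :> rat by rewrite -Dlcm mulfK.
  by rewrite -Dgq in nzg *; field; rewrite nzg nzb nzd.
have b_dvd : (b %| d)%N.
  have := maxd _ Pl; rewrite leq_eqVlt ltnNge dvdn_leq ?dvdn_lcmr // orbF => /eqP <-.
  exact: dvdn_lcml.
have [e De] := dvdnP b_dvd.
have -> : d%:R * c = e%:R * (numq c)%:~R by rewrite De natrM -Dcb; ring.
by rewrite rpredM ?rpred_nat ?rpred_int.
Qed.

Lemma inZaP x : inZa alpha x <->
  exists Y : {poly rat}, [/\ Y \is a polyOver Num.int, (size Y <= N)%N & x = ev Y].
Proof.
split=> [[q [/floorpP[q' ->] ->]] | [Y [ZY _ ->]]]; last first.
  exists (map_poly ratr Y); split=> //; apply/polyOverP=> i.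
  by rewrite coef_map Cint_rat (polyOverP ZY).
pose g : {poly int} := 'X^N - m%:P; have mon_g : g \is monic by apply: monicXnsubC.
pose r := Pdiv.CommonRing.rmodp q' g.
exists (map_poly intr r); split.
- by apply/polyOverP=> i; rewrite coef_map rpred_int.
- have := Pdiv.Ring.ltn_rmodpN0 q' (monic_neq0 mon_g); rewrite size_XnsubC // -/r ltnS.
  by rewrite size_map_inj_poly //; apply: intr_inj.
rewrite /ev map_poly_ratr_intr {1}(Pdiv.RingMonic.rdivp_eq mon_g q') rmorphD rmorphM /=.
rewrite hornerD hornerM {2}/g rmorphB /= map_polyXn map_polyC hornerD hornerN hornerXn hornerC.
by rewrite alphaN subrr mulr0 add0r.
Qed.

Lemma inQaP x : inQa alpha x -> exists2 Y : {poly rat}, (size Y <= N)%N & x = ev Y.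
Proof.
move=> [q [/polyOverP Qq ->]]; pose f : {poly rat} := 'X^N - m%:~R%:P.
pose q' : {poly rat} := \poly_(i < size q) getCrat q`_i.
have -> : q = map_poly ratr q'.
  apply/polyP=> i; rewrite coef_map coef_poly; case: ltnP => [_ | le];
    first by rewrite /= getCratK.
  by rewrite [LHS]nth_default // raddf0.
have nzf : f != 0 by apply/monic_neq0/monicXnsubC.
exists (q' %% f); first by rewrite -ltnS -(size_XnsubC (m%:~R : rat) N_gt0) ltn_modp.
rewrite {1}(divp_eq q' f) rmorphD rmorphM /= hornerD hornerM.
by rewrite (horner_ratr_pure alphaN) mulr0 add0r.
Qed.

Variables (D : nat -> nat) (h : nat -> {poly rat}).
Hypothesis D_gt0 : forall i, (i < N)%N -> (0 < D i)%N.
Hypothesis Ah : forall i, (i < N)%N -> ev (h i) \in Aint.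
Hypothesis size_h : forall i, (i < N)%N -> (size (h i) <= i.+1)%N.
Hypothesis lead_h : forall i, (i < N)%N -> (h i)`_i = (D i)%:R^-1.
Hypothesis D_int : forall i Y, (i < N)%N -> ev Y \in Aint -> (size Y <= i.+1)%N ->
  (D i)%:R * Y`_i \is a Num.int.

Let reduce_mod n Y : (n <= N)%N -> ev Y \in Aint -> (size Y <= n)%N ->
  exists2 a : nat -> nat, (forall i, (i < n)%N -> (a i < D i)%N) &
    Y - \sum_(i < n) (a i)%:R *: h i \is a polyOver Num.int.
Proof.
elim: n Y => [|n IHn] Y lt_nN AY sY.
  exists (fun=> 0%N) => //; rewrite big_ord0 subr0.
  by move: sY; rewrite leqn0 size_poly_eq0 => /eqP->; apply/polyOverP=> i; rewrite coef0 rpred0.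
have /intrP[c Dc] := D_int lt_nN AY sY; have Dn_gt0 := D_gt0 lt_nN.
have nzD : (D n)%:R != 0 :> rat by rewrite pnatr_eq0 -lt0n.
pose t := (c %/ D n)%Z; pose b := `|(c %% D n)%Z|%N.
have Db : (c %% D n)%Z = b%:Z by rewrite /b gez0_abs // modz_ge0 // eqz_nat -lt0n.
have lt_b : (b < D n)%N by rewrite -ltz_nat -Db ltz_pmod // ltz_nat.
have Dc' : c%:~R = t%:~R * (D n)%:R + b%:R :> rat.
  by rewrite {1}(divz_eq c (D n)) intrD intrM Db.
(* The remainder [b] is the digit of [h n]; the quotient [t] is absorbed by ['X^n], which lies in
   Z[alpha]. *)
pose Y' := Y - (b%:R *: h n + t%:~R *: 'X^n).
have AY' : ev Y' \in Aint by rewrite /Y' evB rpredB // (Aev_comb b t) // Ah.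
have sY' : (size Y' <= n)%N.
  apply/leq_sizeP=> j; rewrite leq_eqVlt /Y' => /predU1P[<- | lt_nj].
    rewrite coefB coefD !coefZ coefXn eqxx lead_h // mulr1.
    apply: (mulfI nzD); rewrite mulr0 mulrBr Dc Dc' mulrDr; field.
    exact: nzD.
  have zero (Z : {poly rat}) : (size Z <= n.+1)%N -> Z`_j = 0.
    by move=> sZ; rewrite nth_default // (leq_trans sZ).
  by rewrite coefB coefD !coefZ !zero ?size_h ?size_polyXn // !mulr0 subrr.
have [a lt_a Za] := IHn Y' (ltnW lt_nN) AY' sY'.
exists (fun i => if i == n then b else a i) => [i|].
  by rewrite ltnS leq_eqVlt; case: eqP => [-> | _ /lt_a].
rewrite big_ord_recr /= eqxx (eq_bigr (fun i : 'I_n => (a i)%:R *: h i)); last first.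
  by move=> i _; rewrite ltn_eqF.
rewrite -[X in X \is a _](addrK (t%:~R *: 'X^n)).
have -> : Y - (\sum_(i < n) (a i)%:R *: h i + b%:R *: h n) + t%:~R *: 'X^n - t%:~R *: 'X^n =
  (Y' - \sum_(i < n) (a i)%:R *: h i) + t%:~R *: 'X^n by rewrite /Y'; ring.
apply/polyOverP=> i; rewrite coefD rpredD ?(polyOverP Za) //.
by rewrite coefZ coefXn rpredM ?rpred_int ?rpred_nat.
Qed.

Let comb (a : nat -> nat) := \sum_(i < N) (a i)%:R *: h i.

Let size_comb a : (size (comb a) <= N)%N.
Proof.
apply: leq_trans (size_sum _ _ _) _; apply/bigmax_leqP=> i _.
by apply: leq_trans (size_scale_leq _ _) _; apply: leq_trans (size_h (ltn_ord i)) _.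
Qed.

Let Aev_combN a : ev (comb a) \in Aint.
Proof.
rewrite /comb; elim/big_ind: _ => [|Y Z AY AZ|i _].
- by rewrite /ev rmorph0 horner0 Aint0.
- by rewrite evD rpredD.
by rewrite evZ ratr_nat rpredM ?Ah // (Aint_int (a i)).
Qed.

(** Digits are compared from the top degree down: there the difference is a multiple of [D n] and
    smaller than it. *)
Let comb_inj a b : (forall i, (i < N)%N -> (a i < D i)%N) ->
  (forall i, (i < N)%N -> (b i < D i)%N) ->
  comb a - comb b \is a polyOver Num.int -> forall i, (i < N)%N -> a i = b i.
Proof.
move=> lt_a lt_b Zab.
have step n : (n < N)%N -> (forall i, (n < i < N)%N -> a i = b i) -> a n = b n.
  move=> lt_nN eq_ab; have := polyOverP Zab n.
  have nzD : (D n)%:R != 0 :> rat by rewrite pnatr_eq0 -lt0n D_gt0.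
  have -> : (comb a - comb b)`_n = ((a n)%:R - (b n)%:R) / (D n)%:R.
    rewrite /comb -sumrB coef_sum (bigD1 (Ordinal lt_nN)) //= big1 => [|i neq_in].
      by rewrite addr0 coefB !coefZ lead_h // mulrBl.
    have [lt_in | lt_ni | eq_in] := ltngtP i n.
    - by rewrite coefB !coefZ (nth_default 0 (leq_trans (size_h (ltn_ord i)) lt_in)) !mulr0 subrr.
    - have -> : a i = b i by apply: eq_ab; rewrite lt_ni ltn_ord.
      by rewrite subrr coef0.
    by case/eqP: neq_in; apply/val_inj; rewrite /= eq_in.
  move=> /intrP[c Dc]; have {}Dc : ((a n)%:Z - (b n)%:Z = c * (D n)%:Z)%R.
    by apply: (@intr_inj rat); rewrite intrB intrM -Dc divfK.
  have := lt_a n lt_nN; have := lt_b n lt_nN; move: Dc; clear.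
  by case: (ltrgtP c 0); nia.
move=> i lt_iN; have [j Dj] := ubnP (N - i); elim: j i lt_iN Dj => // j IHj i lt_iN lt_j.
apply: step => // i' /andP[lt_ii' lt_i'N]; apply: IHj => //.
by move: lt_j lt_ii' lt_i'N; clear; lia.
Qed.

(** The sums of [a i] times [h i], with digits [a i < D i], meet every class exactly once. *)
Lemma is_index_prod : is_index alpha (\prod_(i < N) D i).
Proof.
pose T := {dffun forall i : 'I_N, 'I_(D i)}.
pose rep (g : T) (i : nat) : nat := if insub i is Some i' then g i' else 0%N.
have repE (g : T) (i : 'I_N) : rep g i = g i by rewrite /rep valK.
have rep_lt (g : T) i : (i < N)%N -> (rep g i < D i)%N.
  by move=> lt_iN; rewrite -[i]/(nat_of_ord (Ordinal lt_iN)) repE.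
have cardT : #|{: T}| = (\prod_(i < N) D i)%N.
  rewrite card_dep_ffun foldrE big_map big_enum /=.
  by apply: eq_bigr => i _; rewrite card_ord.
pose s := [seq ev (comb (rep g)) | g <- enum {: T}].
have sz : size s = (\prod_(i < N) D i)%N by rewrite size_map -cardE.
have snth i : (i < \prod_(i < N) D i)%N -> exists g : T,
    index g (enum {: T}) = i /\ s`_i = ev (comb (rep g)).
  rewrite -sz size_map => lt_i.
  have [g0 _] : exists g0 : T, True by case: (enum {: T}) lt_i => // g0; exists g0.
  by exists (nth g0 (enum {: T}) i); rewrite index_uniq ?enum_uniq // /s (nth_map g0).
exists s; split=> // [i lt_i | i j lt_i lt_j neq_ij | x [/inQaP[Y sY ->] AY]].
- have [g [_ ->]] := snth i lt_i; split; last exact: Aev_combN.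
  exists (map_poly ratr (comb (rep g))); split=> //.
  by apply/polyOverP=> l; rewrite coef_map Crat_rat.
- have [g [Dg ->]] := snth i lt_i; have [g' [Dg' ->]] := snth j lt_j.
  move=> /inZaP[Y [ZY sY]]; rewrite -evB => Dev.
  have DY : comb (rep g) - comb (rep g') = Y.
    apply: (horner_pure_inj N_gt0 alphaN X_irr) Dev => //; apply: leq_trans (size_polyD _ _) _.
    by rewrite size_polyN geq_max !size_comb.
  apply: neq_ij; rewrite -Dg -Dg'; congr (index _ _); apply/ffunP=> l; apply/val_inj.
  by have := comb_inj (rep_lt g) (rep_lt g'); rewrite DY => /(_ ZY l (ltn_ord l)); rewrite !repE.
have [a lt_a Za] := reduce_mod (leqnn N) AY sY.
pose g : T := [ffun i : 'I_N => Ordinal (lt_a i (ltn_ord i))].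
have lt_g : (index g (enum {: T}) < size (enum {: T}))%N by rewrite index_mem mem_enum.
exists (index g (enum {: T})); first by rewrite -sz size_map.
have -> : s`_(index g (enum {: T})) = ev (comb a).
  rewrite /s (nth_map g _ _ lt_g) nth_index ?mem_enum //.
  congr ev; apply: eq_bigr => i _; rewrite repE ffunE //.
apply/inZaP; exists (Y - comb a); rewrite evB; split=> //.
by apply: leq_trans (size_polyD _ _) _; rewrite size_polyN geq_max sY size_comb.
Qed.

End LatticeIndex.

(** Sending each representative of one system to the congruent one of the other is injective; so a
    computation of one index applies to every [n] satisfying [is_index]. *)
Lemma is_index_uniq (a : algC) n n' : is_index a n -> is_index a n' -> n = n'.
Proof.
have Zsub x y : inZa a x -> inZa a y -> inZa a (x - y).
  move=> [q [Zq ->]] [r [Zr ->]]; exists (q - r).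
  by split; [apply/polyOverP=> i; rewrite coefB rpredB ?(polyOverP Zq) ?(polyOverP Zr)
    | rewrite hornerD hornerN].
suff le_index j j' : is_index a j -> is_index a j' -> (j <= j')%N.
  by move=> ind ind'; apply/eqP; rewrite eqn_leq !le_index.
move=> [s [_ Os inc_s _]] [t [_ _ _ cov_t]].
have /choice[f Df] : forall i : 'I_j, exists l : 'I_j', inZa a (s`_i - t`_l).
  by move=> i; have [l lt_l] := cov_t _ (Os i (ltn_ord i)); exists (Ordinal lt_l).
have inj_f : injective f.
  move=> i l Dfil; apply/val_inj; apply: contrapT => neq_il.
  apply: (inc_s i l) => //; have := Zsub _ _ (Df i) (Df l).
  by rewrite Dfil opprB addrA subrK.
by have := leq_card f inj_f; rewrite !card_ord.
Qed.

(** * The basis of the maximal order at p *)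

(** The last clause isolates the coefficient on the basis element of top degree, the only one that
    [lead_bound] inspects. *)
Lemma triangular_expansion (F : fieldType) (N : nat) (W : nat -> {poly F}) :
  (forall r, (r < N)%N -> size (W r) = (N - r)%N) ->
  forall n (Y : {poly F}), (n <= N)%N -> (size Y <= n)%N -> exists c : nat -> F,
  [/\ forall r, (r < N - n)%N -> c r = 0, Y = \sum_(r < N) c r *: W r &
      (0 < n)%N -> c (N - n)%N * (W (N - n)%N)`_n.-1 = Y`_n.-1].
Proof.
move=> sW; elim=> [|n IHn] Y le_nN sY.
  exists (fun=> 0); split=> //; rewrite big1 => [|r _]; last by rewrite scale0r.
  by move: sY; rewrite leqn0 size_poly_eq0 => /eqP.
set r0 := (N - n.+1)%N; have lt_r0 : (r0 < N)%N by rewrite /r0; lia.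
have sWr0 : size (W r0) = n.+1 by rewrite sW // /r0; lia.
have nzW : (W r0)`_n != 0.
  by have -> : (W r0)`_n = lead_coef (W r0); [rewrite lead_coefE sWr0
    | rewrite lead_coef_eq0 -size_poly_eq0 sWr0].
pose e := Y`_n / (W r0)`_n; pose Y' := Y - e *: W r0.
have sY' : (size Y' <= n)%N.
  apply/leq_sizeP=> j; rewrite leq_eqVlt coefB coefZ => /predU1P[<- | lt_nj].
    by rewrite divfK // subrr.
  by rewrite !nth_default ?mulr0 ?subrr // ?sWr0 // (leq_trans sY).
have [c [c0 DY' _]] := IHn Y' (ltnW le_nN) sY'.
exists (fun r => if r == r0 then e else c r); split=> [r lt_r | | _].
- by rewrite ltn_eqF // c0 //; move: lt_r; rewrite /r0; lia.
- rewrite (bigD1 (Ordinal lt_r0)) //= eqxx; apply/eqP; rewrite -subr_eq0 opprD addrA -/Y' DY'.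
  rewrite (bigD1 (Ordinal lt_r0)) //= c0 ?scale0r ?add0r; last by rewrite /r0; lia.
  rewrite subr_eq0; apply/eqP; apply: eq_bigr => r neq_r; case: eqP => // Dr.
  by case/eqP: neq_r; apply: val_inj.
by rewrite eqxx /= divfK.
Qed.

(* The degree [p ^ k - 1 - r] of the integral basis belongs to the exponent
   [j = k - block p b0 r] of [p] in the denominator. *)
Definition block (p b0 r : nat) : nat := maxn b0 (up_log p r.+1).

Lemma block_le p b0 r c : (1 < p)%N -> (b0 <= c)%N -> (r < p ^ c)%N -> (block p b0 r <= c)%N.
Proof. by move=> p_gt1 le_b0c lt_r; rewrite geq_max le_b0c up_log_min. Qed.

Lemma ltn_expn_block p b0 r : (1 < p)%N -> (r < p ^ block p b0 r)%N.
Proof.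
move=> p_gt1; apply: leq_trans (up_logP r.+1 p_gt1) _.
by rewrite leq_pexp2l ?(ltnW p_gt1) // leq_maxr.
Qed.

(** Beyond [b0], minimality of the block [b] gives p^(b-1) <= r, so p^b - 1 - r stays below (p - 1)
    p^(b-1). *)
Lemma block_slope p b0 r : (1 < p)%N ->
  ((p ^ block p b0 r).-1 - r < slope_length p b0 (block p b0 r))%N.
Proof.
move=> p_gt1; have p_gt0 := ltnW p_gt1; have lt_r := ltn_expn_block b0 r p_gt1.
rewrite /slope_length; case: (leqP (block p b0 r) b0) => [le_b | lt_b].
  have -> : block p b0 r = b0 by apply/eqP; rewrite eqn_leq le_b leq_maxl.
  by have : (0 < p ^ b0)%N; [rewrite expn_gt0 p_gt0 | lia].
have Db : block p b0 r = up_log p r.+1.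
  by rewrite /block; apply/maxn_idPr; move: lt_b; rewrite /block; lia.
have r_gt0 : (0 < r)%N.
  by rewrite lt0n; apply/eqP=> r0; move: lt_b; rewrite Db r0 up_log1.
have := @up_log_gtn p r.+1 p_gt1 r_gt0; rewrite -Db => lt_q.
have Dpq : (p ^ block p b0 r = p ^ (block p b0 r).-1 + p.-1 * p ^ (block p b0 r).-1)%N.
  by rewrite -mulSn prednK // -expnS prednK // (leq_ltn_trans (leq0n _) lt_b).
by move: lt_q lt_r; rewrite Dpq; clear; lia.
Qed.

(** From [c] to [c.+1] each of the [p ^ c] old summands grows by 1 and the new ones vanish, their
    block being at least [c.+1]. *)
Lemma sum_block p b0 c : (1 < p)%N -> (b0 <= c)%N ->
  (p.-1 * \sum_(0 <= r < p ^ c) (c - block p b0 r) + p ^ b0 = p ^ c)%N.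
Proof.
move=> p_gt1; have p_gt0 := ltnW p_gt1.
elim: c => [|c IHc] le_b0c.
  have -> : b0 = 0%N by lia.
  by rewrite expn0 big_nat1 sub0n muln0.
move: le_b0c; rewrite leq_eqVlt => /predU1P[-> | le_b0c].
  rewrite big1 ?muln0 // => r _; apply/eqP; rewrite subn_eq0; exact: leq_maxl.
have le_pc : (p ^ c <= p ^ c.+1)%N by rewrite leq_pexp2l.
rewrite (@big_cat_nat _ _ _ (p ^ c)) //=.
have -> : (\sum_(p ^ c <= r < p ^ c.+1) (c.+1 - block p b0 r) = 0)%N.
  rewrite big_nat_cond big1 // => r /andP[/andP[le_r _] _]; apply/eqP; rewrite subn_eq0;
    apply: leq_trans (leq_maxr _ _).
  have := up_logP r.+1 p_gt1; rewrite leqNgt => le1; rewrite ltnNge; apply: contra le1 => le2.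
  by apply: leq_ltn_trans (leq_trans (leq_pexp2l p_gt0 le2) le_r) _.
rewrite addn0 (@eq_big_nat _ _ _ _ _ _ (fun r => (c - block p b0 r) + 1)%N); last first.
  by move=> r /andP[_ lt_r]; rewrite subSn ?addn1 // block_le.
rewrite big_split /= sum_nat_const_nat subn0 muln1 mulnDr addnAC IHc // expnS.
by rewrite -mulSn prednK.
Qed.

Lemma fermat_int (p : nat) (m : int) : prime p -> (p%:Z %| m ^+ p - m)%Z.
Proof.
move=> p_pr; rewrite (dvdz_pcharf (pchar_Fp p_pr)) intrB rmorphXn /= subr_eq0.
by have := expf_card (m%:~R : 'F_p); rewrite card_Fp // => ->.
Qed.

(** Passing from d^p to higher iterates adds x^p - d^p with x close to [d], whose valuation is
    strictly larger than that of [x - d]. *)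
Lemma val_expn_sub_self (p : nat) (v : algC -> rat) (d : algC) j : prime p ->
  padic_valuation p v -> d \in Aint -> d ^+ p - d != 0 -> 0 < v (d ^+ p - d) ->
  d ^+ (p ^ j.+1) - d != 0 /\ v (d ^+ (p ^ j.+1) - d) = v (d ^+ p - d).
Proof.
move=> p_pr val_v Ad nz v_gt0; elim: j => [|j [IHnz IHv]]; first by rewrite expn1.
set x := d ^+ (p ^ j.+1) in IHnz IHv *.
have Ax : x \in Aint by rewrite rpredX.
have -> : d ^+ (p ^ j.+2) - d = (d ^+ p - d) + (x ^+ p - d ^+ p).
  by rewrite expnSr exprM -/x; ring.
apply: (val_add_gt val_v) => //; rewrite subrXX.
pose S := \sum_(i < p) x ^+ (p.-1 - i) * d ^+ i.
have gtS : val_gt v 0 S.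
  (* Modulo [x - d], the cofactor [S] is p d^(p-1). *)
  have -> : S = d ^+ p.-1 * p%:R +
      (\sum_(i < p) d ^+ i * \sum_(l < p.-1 - i) x ^+ ((p.-1 - i).-1 - l) * d ^+ l) * (x - d).
    rewrite mulr_suml mulr_natr -[p in _ *+ p]card_ord -sumr_const -big_split /=.
    apply: eq_bigr => i _; rewrite -mulrA [_ * (x - d)]mulrC -subrXX mulrBr -exprD.
    have -> : (i + (p.-1 - i) = p.-1)%N by have := ltn_ord i; lia.
    by rewrite mulrC; ring.
  apply: (val_gtD val_v); apply: (val_gtM val_v); rewrite ?rpredX //.
  - by rewrite /val_gt (pvalp val_v) orbT.
  - rewrite rpred_sum // => i _; rewrite rpredM ?rpredX // rpred_sum // => l _.
    by rewrite rpredM ?rpredX.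
  by rewrite /val_gt IHv v_gt0 orbT.
rewrite -/S /val_gt; have [-> | nzS] := eqVneq S 0; first by rewrite mulr0 eqxx.
move: gtS; rewrite /val_gt (negPf nzS) /= => vS.
by rewrite mulf_eq0 (negPf IHnz) (negPf nzS) (pvalM val_v) // IHv /=; lra.
Qed.

(** * The p-index of a root of X^(p^k) - m *)

Section PureIndex.

Variables (m : int) (p k : nat) (alpha : algC).
Hypotheses (m_neq1 : m != 1) (m_neqN1 : m != -1).
Hypothesis m_sqf : forall q : nat, prime q -> ~~ (q ^ 2 %| `|m|)%N.
Hypotheses (p_pr : prime p) (p_ndvd : ~~ (p %| `|m|)%N) (k_gt0 : (0 < k)%N).
Hypothesis alphaN : alpha ^+ (p ^ k) = m%:~R.

Let s := (logn p `|m ^+ p - m|%N).-1.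
Let b0 := (k - s)%N.
Let d : algC := m%:~R.

Let p_gt0 : (0 < p)%N := prime_gt0 p_pr.
Let p_gt1 : (1 < p)%N := prime_gt1 p_pr.
Let N_gt0 : (0 < p ^ k)%N. Proof. by rewrite expn_gt0 p_gt0. Qed.

Let m_neq0 : m != 0.
Proof. by apply: contraNneq p_ndvd => ->. Qed.

Let m_gt1 : (1 < `|m|)%N.
Proof. by move: m_neq0 m_neq1 m_neqN1; clear; lia. Qed.

Let mp_neq : m ^+ p - m != 0.
Proof.
rewrite subr_eq0; apply/eqP=> /(congr1 absz); rewrite abszX => D.
have := ltn_exp2l 1 p m_gt1; rewrite D expn1 ltnn p_gt1 //.
Qed.

(** By Fermat the valuation is positive, so the truncated predecessor defining [s] loses nothing. *)
Let s_spec : logn p `|m ^+ p - m|%N = s.+1.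
Proof.
rewrite /s prednK // lognE p_pr absz_gt0 mp_neq /=.
by have := fermat_int m p_pr; rewrite dvdzE => ->.
Qed.

Let val_d v : padic_valuation p v -> v d = 0.
Proof.
by move=> val_v; rewrite (val_int p_pr val_v m_neq0) lognE (negPf p_ndvd) !andbF.
Qed.

Let val_dN v : padic_valuation p v ->
  d != d ^+ (p ^ k) /\ v (d - d ^+ (p ^ k)) = s%:R + 1.
Proof.
move=> val_v; have Dp : d ^+ p - d = (m ^+ p - m)%:~R by rewrite intrB rmorphXn.
have nzp : d ^+ p - d != 0 by rewrite Dp intr_eq0.
have vp : v (d ^+ p - d) = s%:R + 1 by rewrite Dp (val_int p_pr val_v) // s_spec natr1.
have Ad : d \in Aint by rewrite /d Aint_int.
have [|nz v_eq] := val_expn_sub_self (k.-1) p_pr val_v Ad nzp.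
  by rewrite vp natr1 ltr0n.
rewrite prednK // in nz v_eq; split; first by rewrite eq_sym -subr_eq0.
by rewrite -opprB (pvalN val_v) // v_eq.
Qed.

Let X_irr := pure_irreducible N_gt0 m_neq1 m_neqN1 m_sqf.

Let Aint_of_pow x : x ^+ (p ^ k) = d -> x \in Aint.
Proof.
move=> xN; apply: (@root_monic_Aint ('X^(p ^ k) - d%:P)); rewrite ?monicXnsubC //.
  by rewrite /root hornerD hornerN hornerXn hornerC xN subrr.
apply/polyOverP=> i; rewrite coefB coefC coefXn rpredB ?rpred_nat //.
by case: ifP; rewrite ?rpred_int ?rpred0.
Qed.

Let Ad : d \in Aint. Proof. exact: Aint_int. Qed.

(** Multiplied by p^(k-b) it is visibly integral, so only valuations above [p] matter; there the
    upper bound of [places_exist], taken at [alpha] itself, says exactly that its valuation is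
    nonnegative. *)
Lemma cofactor_quot_Aint b : (b0 <= b <= k)%N -> cofactor_quot p k b d alpha \in Aint.
Proof.
move=> bP; have /andP[_ lebk] := bP; have Aa := Aint_of_pow alphaN.
have nzp (j : nat) : (p ^ j)%:R != 0 :> algC by rewrite pnatr_eq0 -lt0n expn_gt0 p_gt0.
apply: (Aint_of_valuations (p := p) (e := k - b)) => // [|v val_v nz_theta].
  rewrite -natrX /cofactor_quot mulrC divfK // rpred_sum // => i _.
  by rewrite rpredM ?rpredX.
have [neq_d v_dN] := val_dN val_v.
have nzd : d != 0 by rewrite intr_eq0.
have [X [delta [_ v_le _]]] := places_exist p_pr val_v (val_d val_v) nzd alphaN neq_d v_dN.
have := v_le _ b alphaN bP; have := congr1 v (cofactor_quotE d alpha p_gt0 lebk).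
have nzN : alpha ^+ (p ^ k) - d ^+ (p ^ k) != 0 by rewrite alphaN subr_eq0.
have nzb : alpha ^+ (p ^ b) - d ^+ (p ^ b) != 0.
  by apply: contraNneq nzN => D0; rewrite (cofactor_quotE d alpha p_gt0 lebk) D0 mul0r.
have nzt := mulf_neq0 (nzp (k - b)%N) nz_theta.
rewrite (pvalM val_v nzb nzt) (pvalM val_v (nzp _) nz_theta) alphaN v_dN.
rewrite (val_nat p_pr val_v) ?expn_gt0 ?p_gt0 // pfactorK //; lra.
Qed.

Let c b : rat := (m ^+ (p ^ b))%:~R.

Let Spoly b : {poly rat} := \sum_(i < p ^ (k - b))
  ('X^(p ^ b)) ^+ ((p ^ (k - b)).-1 - i) * ((c b)%:P) ^+ i.

Let Theta b : {poly rat} := (p ^ (k - b))%:R^-1 *: Spoly b.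

(** [Theta b] has degree p^k - p^b, and the power of X - m completes it to p^k - 1 - r. *)
Let W r : {poly rat} :=
  Theta (block p b0 r) * ('X - m%:~R%:P) ^+ ((p ^ block p b0 r).-1 - r).

Let horner_Theta b x : (map_poly ratr (Theta b)).[x] = cofactor_quot p k b d x.
Proof.
rewrite /Theta map_polyZ hornerZ fmorphV /= ratr_nat mulrC /cofactor_quot; congr (_ / _).
rewrite rmorph_sum /= horner_sum; apply: eq_bigr => i _.
rewrite rmorphM !rmorphXn /= map_polyX map_polyC /= ratr_int.
by rewrite hornerM !horner_exp hornerX hornerC rmorphXn.
Qed.

Let horner_W r x : (map_poly ratr (W r)).[x] =
  cofactor_quot p k (block p b0 r) d x * (x - d) ^+ ((p ^ block p b0 r).-1 - r).
Proof.
rewrite rmorphM hornerM horner_Theta rmorphXn /= horner_exp rmorphB /= map_polyX map_polyC /=.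
by rewrite ratr_int hornerD hornerN hornerX hornerC.
Qed.

Let le_b0k : (b0 <= k)%N. Proof. exact: leq_subr. Qed.

Let block_k r : (r < p ^ k)%N -> (b0 <= block p b0 r <= k)%N.
Proof. by move=> lt_r; rewrite leq_maxl block_le. Qed.

Let monic_Spoly b : (b <= k)%N -> Spoly b \is monic /\ size (Spoly b) = (p ^ k - p ^ b).+1.
Proof.
move=> lebk; have pb_gt0 : (0 < p ^ b)%N by rewrite expn_gt0 p_gt0.
have pkb_gt0 : (0 < p ^ (k - b))%N by rewrite expn_gt0 p_gt0.
have DS : ('X^(p ^ b) - (c b)%:P) * Spoly b = 'X^(p ^ k) - (c b ^+ (p ^ (k - b)))%:P.
  by rewrite -subrXX -exprM -expnD subnKC // rmorphXn.
have mon1 : 'X^(p ^ b) - (c b)%:P \is monic := monicXnsubC _ pb_gt0.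
have mon2 := monicXnsubC (c b ^+ (p ^ (k - b))) N_gt0.
have monS : Spoly b \is monic by rewrite -(monicMl _ mon1) DS.
split=> //; have := congr1 (fun Q : {poly rat} => size Q) DS.
rewrite size_monicM ?monic_neq0 // !size_XnsubC // addSn /= => Dsize.
by rewrite -subSn ?leq_pexp2l // -Dsize addKn.
Qed.

Let size_lead_W r : (r < p ^ k)%N -> size (W r) = (p ^ k - r)%N /\
  lead_coef (W r) = (p ^ (k - block p b0 r))%:R^-1.
Proof.
move=> lt_r; have /andP[_ lebk] := block_k lt_r.
have [monS sS] := monic_Spoly lebk; set b := block p b0 r in lebk monS sS *.
have lt_rb : (r < p ^ b)%N := ltn_expn_block b0 r p_gt1.
have nzp : (p ^ (k - b))%:R^-1 != 0 :> rat by rewrite invr_eq0 pnatr_eq0 -lt0n expn_gt0 p_gt0.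
have nzS := monic_neq0 monS.
have monX : ('X - m%:~R%:P : {poly rat}) ^+ ((p ^ b).-1 - r) \is monic.
  by rewrite monic_exp ?monicXsubC.
rewrite /W -/b /Theta -scalerAl lead_coefZ (monicP (_ : Spoly b * _ \is monic)) ?monicMr //.
rewrite mulr1 size_scale // size_Mmonic // sS size_exp_XsubC; split=> //.
have : (p ^ b <= p ^ k)%N by rewrite leq_pexp2l.
by lia.
Qed.

Let Aint_W r : (r < p ^ k)%N -> (map_poly ratr (W r)).[alpha] \in Aint.
Proof.
move=> lt_r; rewrite horner_W rpredM ?cofactor_quot_Aint ?block_k //.
by rewrite rpredX // rpredB // Aint_of_pow.
Qed.

(** Expanded in the [W], the integral [Y] has top coefficient p^j / D, and local independence makes
    its valuation nonnegative. *)
Let lead_bound (Y : {poly rat}) i D : (i < p ^ k)%N -> (0 < D)%N ->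
  (map_poly ratr Y).[alpha] \in Aint -> (size Y <= i.+1)%N -> Y`_i = D%:R^-1 ->
  (logn p D <= k - block p b0 (p ^ k - i.+1))%N.
Proof.
move=> lt_i D_gt0 AY sY DY; set r := (p ^ k - i.+1)%N.
have lt_r : (r < p ^ k)%N by rewrite /r; lia.
have [sWr leadWr] := size_lead_W lt_r.
have [f [_ DfY]] := triangular_expansion (fun r lt => (size_lead_W lt).1) lt_i sY.
rewrite /= -/r => /(_ isT).
have -> : (W r)`_i = lead_coef (W r) by rewrite lead_coefE sWr; congr (_`_ _); rewrite /r; lia.
rewrite leadWr DY => Dfr; set j := (k - _)%N in Dfr *.
have nzpj : (p ^ j)%:R != 0 :> rat by rewrite pnatr_eq0 -lt0n expn_gt0 p_gt0.
have nzD : D%:R != 0 :> rat by rewrite pnatr_eq0 -lt0n.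
have {}Dfr : f r = (p ^ j)%:R / D%:R by rewrite -Dfr mulrC divfK.
(* A valuation above [p] exists because the multiples of [p] form a proper ideal: 1/p is rational
   but not an integer. *)
have [] := @valuation_exists p (fun x => exists2 y, y \in Aint & x = p%:R * y) p_pr.
- split=> [_ [y Ay ->] | | _ _ [y Ay ->] [z Az ->] | a _ Aa [y Ay ->] | [y Ay D1]].
  + by rewrite rpredM // (Aint_int p).
  + by exists 0; rewrite ?mulr0.
  + by exists (y + z); rewrite ?rpredD ?mulrDr.
  + by exists (a * y); rewrite ?rpredM // mulrCA.
  have nzp : p%:R != 0 :> algC by rewrite pnatr_eq0 -lt0n.
  have : ratr (p%:R^-1 : rat) \in Aint.
    suff -> : ratr p%:R^-1 = y by [].
    by apply: (mulfI nzp); rewrite -D1 fmorphV /= ratr_nat mulfV.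
  move/(Cint_rat_Aint (Crat_rat _)); rewrite Cint_rat => /intrP[a Da].
  have : (a * p%:Z = 1)%R by apply: (@intr_inj rat); rewrite intrM -Da mulVf // pnatr_eq0 -lt0n.
  by move: p_gt1; clear; case: (ltrgtP a 0); nia.
- by exists 1; rewrite ?mulr1 ?Aint1.
move=> v val_v _.
have [neq_d v_dN] := val_dN val_v; have nzd : d != 0 by rewrite intr_eq0.
have [X [delta [X_root _ [v_Xd v_near v_far [d_gt d_ge d_eq]]]]] :=
  places_exist p_pr val_v (val_d val_v) nzd alphaN neq_d v_dN.
pose bI (l : 'I_(p ^ k)) := block p b0 l; pose eI (l : 'I_(p ^ k)) := ((p ^ bI l).-1 - l)%N.
have bP l : (b0 <= bI l <= k)%N by apply: block_k.
have eP l : (eI l < slope_length p b0 (bI l))%N by apply: block_slope.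
have inj l l' : bI l = bI l' -> eI l = eI l' -> l = l'.
  rewrite /eI => Db; rewrite Db => De; apply: val_inj; move: De.
  have := ltn_expn_block b0 l p_gt1; have := ltn_expn_block b0 l' p_gt1.
  by rewrite -/(bI l) -/(bI l') Db /=; clear; lia.
have Yint a : (b0 <= a <= k)%N -> let y := \sum_l ratr (f (l : 'I_(p ^ k))) *
    (cofactor_quot p k (bI l) d (X a) * (X a - d) ^+ eI l) in y != 0 -> 0 <= v y.
  move=> _ y nzy; suff Dy : y = (map_poly ratr Y).[X a].
    by apply: (val_Aint val_v) nzy; rewrite Dy (Aint_conj_pure alphaN X_irr).
  rewrite DfY rmorph_sum horner_sum; apply: eq_bigr => l _.
  by rewrite /= map_polyZ hornerZ horner_W.
have := independent_coefs p_pr val_v (val_d val_v) neq_d v_dN X_root v_Xd v_near v_far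
  d_gt d_ge d_eq bP eP inj Yint (i := Ordinal lt_r).
rewrite /= Dfr mulf_neq0 ?invr_eq0 // => /(_ isT).
rewrite rmorphM fmorphV /= !ratr_nat (pvalM val_v) ?invr_eq0 ?pnatr_eq0 -?lt0n ?expn_gt0 ?p_gt0
  //.
rewrite (pvalV val_v) ?pnatr_eq0 -?lt0n // !(val_nat p_pr val_v) ?expn_gt0 ?p_gt0 //.
by rewrite pfactorK // subr_ge0 ler_nat.
Qed.

Lemma pure_index_exists : exists n, is_index alpha n /\ (p.-1 * logn p n + p ^ (k - s) = p ^ k)%N.
Proof.
pose P i (Dh : nat * {poly rat}) := (i < p ^ k)%N ->
  [/\ (0 < Dh.1)%N, (map_poly ratr Dh.2).[alpha] \in Aint, (size Dh.2 <= i.+1)%N,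
      Dh.2`_i = Dh.1%:R^-1 & forall Y : {poly rat}, (map_poly ratr Y).[alpha] \in Aint ->
        (size Y <= i.+1)%N -> Dh.1%:R * Y`_i \is a Num.int].
have /choice[Dh DhP] : forall i, exists Dh, P i Dh.
  move=> i; have [lt_i | le_i] := ltnP i (p ^ k); last by exists (0%N, 0); rewrite /P ltnNge le_i.
  by have [D [h Dh]] := leading_denominator N_gt0 m_neq0 alphaN X_irr lt_i; exists (D, h).
have D_gt0 i : (i < p ^ k)%N -> (0 < (Dh i).1)%N by move/DhP=> [].
exists (\prod_(i < p ^ k) (Dh i).1)%N; split.
  apply: (is_index_prod N_gt0 alphaN X_irr D_gt0 (h := fun i => (Dh i).2)) => i.
  - by move=> /DhP[].
  - by move=> /DhP[].
  - by move=> /DhP[].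
  by move=> Y /DhP[_ _ _ _]; apply.
(* One inequality is [lead_bound]; for the other, the integral element [W r] has leading coefficient
   1 / p^j, so p^j divides the denominator. *)
have log_D i : (i < p ^ k)%N -> logn p (Dh i).1 = (k - block p b0 (p ^ k - i.+1))%N.
  move=> lt_i; have [Di_gt0 Ah sh Dlead D_int] := DhP i lt_i.
  apply/eqP; rewrite eqn_leq (lead_bound lt_i Di_gt0 Ah sh Dlead) /=.
  set r := (p ^ k - i.+1)%N; have lt_r : (r < p ^ k)%N by rewrite /r; lia.
  have [sWr leadWr] := size_lead_W lt_r.
  have Dsi : (p ^ k - r = i.+1)%N by rewrite /r; lia.
  have := D_int _ (Aint_W lt_r); rewrite sWr Dsi => /(_ (leqnn _)).
  have -> : (W r)`_i = lead_coef (W r) by rewrite lead_coefE sWr Dsi.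
  rewrite leadWr => /intrP[a Da].
  have Ha : ((Dh i).1%:Z = a * (p ^ (k - block p b0 r))%N%:Z)%R.
    by apply: (@intr_inj rat); rewrite intrM -Da divfK // pnatr_eq0 -lt0n expn_gt0 p_gt0.
  have : ((p ^ (k - block p b0 r))%N%:Z %| (Dh i).1%:Z)%Z by rewrite Ha dvdz_mull.
  by rewrite dvdzE /= pfactor_dvdn.
have -> : logn p (\prod_(i < p ^ k) (Dh i).1) = (\sum_(i < p ^ k) logn p (Dh i).1)%N.
  have : (0 < \prod_(i < p ^ k) (Dh i).1)%N /\
      logn p (\prod_(i < p ^ k) (Dh i).1) = (\sum_(i < p ^ k) logn p (Dh i).1)%N.
    elim/big_rec2: _ => [|i l n _ [n_gt0 <-]]; first by rewrite logn1.
    by rewrite muln_gt0 D_gt0 // n_gt0 lognM ?D_gt0.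
  by case.
rewrite (eq_bigr _ (fun (i : 'I_(p ^ k)) _ => log_D i (ltn_ord i))) (reindex_inj rev_ord_inj) /=.
rewrite (eq_bigr (fun r : 'I_(p ^ k) => (k - block p b0 r)%N)) => [|r _]; last first.
  by congr (_ - block _ _ _)%N; have := ltn_ord r; lia.
by rewrite -(big_mkord predT (fun r => k - block p b0 r)%N) sum_block.
Qed.

End PureIndex.

Theorem theorem3p6 (m : int) (p k : nat) (alpha : algC) :
  m != 1 -> m != -1 -> squarefree_int m ->
  prime p -> ~~ (p %| `|m|)%N -> (0 < k)%N ->
  alpha ^+ (p ^ k) = m%:~R ->
  let s := (logn p `|m ^+ p - m|%N).-1 in
  (exists n, is_index alpha n) /\
  (forall n, is_index alpha n ->
     ((s <= k)%N -> logn p n = ((p ^ k - p ^ (k - s)) %/ (p - 1))%N) /\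
     ((k < s)%N -> logn p n = ((p ^ k - 1) %/ (p - 1))%N)).
Proof.
move=> m1 mN1 m_sqf p_pr p_ndvd k_gt0 alphaN s.
have [n [ind_n Dn]] := pure_index_exists m1 mN1 m_sqf p_pr p_ndvd k_gt0 alphaN.
rewrite -/s in Dn; split=> [|n' /(is_index_uniq ind_n)<-]; first by exists n.
have log_n : logn p n = ((p ^ k - p ^ (k - s)) %/ (p - 1))%N.
  by rewrite -Dn addnK subn1 mulKn // -subn1 subn_gt0 prime_gt1.
(* For [k < s] truncated subtraction gives [k - s = 0], so the second formula is an instance of the
   first. *)
split=> // lt_ks; rewrite log_n; have -> : (k - s = 0)%N by lia.
by rewrite expn0.
Qed.
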